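(* Let $0<a<b\le1$ be real numbers. Then there exists a spectral random measure $\mu$ on $(\mathbb{R},\mathcal{B}(\mathbb{R}))$ with respect to $(\Omega,\mathcal{F})$ such that for every $s\in(a,b)$ there is a Bernoulli measure $\mathbb{P}$ on $\Omega$ with $$\dim_{\mathrm H}\mu(\boldsymbol{\omega})=s\qquad\text{for }\mathbb{P}\text{-a.e. }\boldsymbol{\omega}\in\Omega.$$
   Context: $\Omega=\mathbb{N}^{\mathbb{N}}$ with $\mathbb{N}=\{1,2,3,\dots\}$ is the set of infinite sequences $\boldsymbol{\omega}=\omega_1\omega_2\cdots$ of positive integers, with the metric $d(\boldsymbol{\alpha},\boldsymbol{\beta})=2^{-|\boldsymbol{\alpha}\wedge\boldsymbol{\beta}|}$, where $|\boldsymbol{\alpha}\wedge\boldsymbol{\beta}|$ is the length of the maximal common initial segment ($d=0$ if the sequences are equal). $\mathcal{F}$ is the Borel $\sigma$-algebra of $\Omega$; $\mathcal{B}(\mathbb{R})$ is the Borel $\sigma$-algebra of $\mathbb{R}$. Bernoulli measure: given a probability vector $\mathbf{p}=(p_1,p_2,\dots)$ ($p_j\ge0$, $\sum_{j\ge1}p_j=1$), the associated Bernoulli measure $\mathbb{P}$ is the Borel probability measure on $\Omega$ with $\mathbb{P}(\{\boldsymbol{\omega}:\omega_1=\alpha_1,\dots,\omega_k=\alpha_k\})=p_{\alpha_1}\cdots p_{\alpha_k}$ for all finite words $\alpha_1\cdots\alpha_k$. A mapping $M:\Omega\times\mathcal{B}(\mathbb{R})\to[0,+\infty]$ is a random measure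 on $(\mathbb{R},\mathcal{B}(\mathbb{R}))$ with respect to $(\Omega,\mathcal{F})$ if $\boldsymbol{\omega}\mapsto M(\boldsymbol{\omega},A)$ is $\mathcal{F}$-measurable for every $A\in\mathcal{B}(\mathbb{R})$ and $M(\boldsymbol{\omega})=M(\boldsymbol{\omega},\cdot)$ is a measure for every $\boldsymbol{\omega}\in\Omega$. A Borel probability measure $\nu$ on $\mathbb{R}$ is a spectral measure if there is $\Lambda\subset\mathbb{R}$ such that $\{e^{2\pi i\lambda x}:\lambda\in\Lambda\}$ is an orthonormal basis of $L^2(\nu)$. A random measure $M$ is a spectral random measure if $M(\boldsymbol{\omega})$ is a spectral measure for all $\boldsymbol{\omega}\in\Omega$. For a Borel probability measure $\nu$ on $\mathbb{R}$, $\dim_{\mathrm H}\nu=\inf\{\dim_{\mathrm H}E: E \text{ Borel},\ \nu(E)>0\}$, where $\dim_{\mathrm H}E$ is the Hausdorff dimension of the set $E$. *)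

(* Defs.v *)
From HB Require Import structures.
From mathcomp Require Import all_boot all_order all_algebra.
From mathcomp Require Import all_classical all_reals all_analysis.
From mathcomp Require Import complex.

Set Implicit Arguments.
Unset Strict Implicit.
Unset Printing Implicit Defensive.

Import Order.TTheory GRing.Theory Num.Theory.
Import numFieldNormedType.Exports.

Local Open Scope classical_set_scope.
Local Open Scope ring_scope.
Local Open Scope complex_scope.

Definition posint : Type := {n : nat | (0 < n)%N}.
HB.instance Definition _ :=
  Countable.copy posint {n : nat | (0 < n)%N}.
HB.instance Definition _ := isPointed.Build posint (exist _ 1%N isT).

(* Sequences of positive integers: [w i] is the (i+1)-st letter of [w].  The
   parameter [R] is only the type in which the metric takes its values. *)
Definition Omega (R : realType) : Type := nat -> posint.

Section Omega_metric.
Context {R : realType}.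
Implicit Types u v w : Omega R.

HB.instance Definition _ := Pointed.copy (Omega R) (nat -> posint).

(* For [u <> v], the least index at which they differ is the length of their
   maximal common initial segment, letters being indexed from 0. *)
Definition Omega_dist u v : R :=
  if pselect (exists i, u i != v i) is left h then 2 ^- ex_minn h else 0.

Lemma Omega_dist_lt u v n :
  Omega_dist u v < 2 ^- n <-> forall i, (i <= n)%N -> u i = v i.
Proof.
rewrite /Omega_dist; case: pselect => [h|h].
  case: ex_minnP => m um minm; rewrite ltf_pV2 ?posrE ?exprn_gt0// ltr_eXn2l ?ltr1n//.
  split=> [nm i ilen|H].
    apply/eqP/negPn/negP => /minm; rewrite leqNgt => /negP; apply.
    exact: leq_ltn_trans nm.
  by rewrite ltnNge; apply/negP => /H /eqP; apply/negP.
split=> [_ i _|_]; last by rewrite invr_gt0 exprn_gt0.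
by apply/eqP/negPn/negP => ui; apply: h; exists i.
Qed.

Lemma Omega_dist_cases u v :
  Omega_dist u v = 0 \/ exists n, Omega_dist u v = 2 ^- n.
Proof.
rewrite /Omega_dist; case: pselect => h; last by left.
by right; exists (ex_minn h).
Qed.

Lemma Omega_dist_ge0 u v : 0 <= Omega_dist u v.
Proof.
by case: (Omega_dist_cases u v) => [->|[n ->]] //; rewrite invr_ge0 exprn_ge0.
Qed.

Lemma Omega_distxx u : Omega_dist u u = 0.
Proof.
rewrite /Omega_dist; case: pselect => [h|h //].
by exfalso; case: h => i; rewrite eqxx.
Qed.

Lemma Omega_dist_eq0 u v : Omega_dist u v = 0 -> u = v.
Proof.
move=> d0; apply: funext => i; apply: (Omega_dist_lt u v i).1 (leqnn i).
by rewrite d0 invr_gt0 exprn_gt0.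
Qed.

Lemma Omega_dist_sym u v : Omega_dist u v = Omega_dist v u.
Proof.
rewrite /Omega_dist; case: pselect => [h|h]; case: pselect => [k|k] //.
- by congr (2 ^- _); apply: eq_ex_minn => i; rewrite eq_sym.
- by exfalso; apply: k; case: h => i; rewrite eq_sym; exists i.
- by exfalso; apply: h; case: k => i; rewrite eq_sym; exists i.
Qed.

Lemma Omega_dist_triangle v u w :
  Omega_dist u w <= Omega_dist u v + Omega_dist v w.
Proof.
case: (Omega_dist_cases u w) => [->|[n uwn]].
  by rewrite addr_ge0 ?Omega_dist_ge0.
rewrite leNgt; apply/negP => H.
have uv : Omega_dist u v < 2 ^- n.
  by rewrite -uwn; apply: le_lt_trans H; rewrite lerDl Omega_dist_ge0.
have vw : Omega_dist v w < 2 ^- n.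
  by rewrite -uwn; apply: le_lt_trans H; rewrite lerDr Omega_dist_ge0.
have : Omega_dist u w < 2 ^- n.
  apply/Omega_dist_lt => i ni.
  by rewrite ((Omega_dist_lt _ _ _).1 uv)// ((Omega_dist_lt _ _ _).1 vw).
by rewrite uwn ltxx.
Qed.

HB.instance Definition _ := isMetric.Build R (Omega R)
  Omega_distxx Omega_dist_eq0 Omega_dist_sym Omega_dist_triangle.

End Omega_metric.

Definition borel_Omega (R : realType) := g_sigma_algebraType (@open (Omega R)).

(* [p j] is the weight of the letter [j >= 1]; [p 0] plays no role. *)
Definition bernoulli_measure (R : realType) (P : probability (borel_Omega R) R)
    : Prop :=
  exists p : nat -> R,
    [/\ forall j, (1 <= j)%N -> 0 <= p j,
        (\sum_(1 <= j <oo) (p j)%:E = 1)%E &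
        forall (k : nat) (alpha : k.-tuple posint),
          P [set w : borel_Omega R | forall i : 'I_k, w (val i) = tnth alpha i]
          = (\prod_(i < k) p (val (tnth alpha i)))%:E].

Section spectral_measure.
Context {R : realType} (nu : {measure set (measurableTypeR R) -> \bar R}).
Implicit Types f g : R -> R[i].

Definition cintegral f : R[i] :=
  (\int[nu]_x complex.Re (f x)) +i* (\int[nu]_x complex.Im (f x)).

Definition square_integrable f : Prop :=
  [/\ measurable_fun [set: measurableTypeR R] (fun x => complex.Re (f x)),
      measurable_fun [set: measurableTypeR R] (fun x => complex.Im (f x)) &
      (\int[nu]_x (Normc.normc (f x) ^+ 2)%:E < +oo)%E].

Definition L2_inner f g : R[i] := cintegral (fun x => f x * (g x)^*).

(* Orthonormal family with dense linear span in L^2(nu). *)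
Definition orthonormal_basis (I : eqType) (D : set I) (e : I -> R -> R[i])
    : Prop :=
  [/\ forall i, D i -> square_integrable (e i),
      forall i j, D i -> D j -> L2_inner (e i) (e j) = (i == j)%:R &
      forall f, square_integrable f -> forall eps : R, 0 < eps ->
        exists (s : seq I) (c : I -> R[i]),
          (forall i, i \in s -> D i) /\
          (\int[nu]_x (Normc.normc (f x - \sum_(i <- s) c i * e i x) ^+ 2)%:E
             < eps%:E)%E].

(* x |-> exp (2 pi i lambda x) *)
Definition fourier_exp (lambda x : R) : R[i] :=
  cos (2 * pi * lambda * x) +i* sin (2 * pi * lambda * x).

Definition spectral_measure : Prop :=
  nu [set: R] = 1%E /\
  exists Lambda : set R, orthonormal_basis Lambda fourier_exp.

End spectral_measure.

(* Kernels are exactly the random measures: each [M w] is a measure and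
   [w |-> M w A] is measurable for every measurable [A]. *)
Definition spectral_random_measure (R : realType)
    (M : R.-ker (borel_Omega R) ~> (measurableTypeR R)) : Prop :=
  forall w, spectral_measure (M w).

Section hausdorff_dimension.
Context {R : realType}.
Local Open Scope ereal_scope.

Definition diameter (E : set R) : \bar R :=
  ereal_sup [set `|z.1 - z.2|%:E | z in E `*` E].

(* The empty set contributes 0, a nonempty set of diameter 0 contributes 1 when
   [s = 0]. *)
Definition diameter_pow (s : R) (E : set R) : \bar R :=
  if pselect (E = set0) is left _ then 0 else poweR (diameter E) s.

Definition hausdorff_content (s delta : R) (E : set R) : \bar R :=
  ereal_inf [set \sum_(0 <= n <oo) diameter_pow s (U n) |
    U in [set U : nat -> set R |
      E `<=` \bigcup_n U n /\ forall n, diameter (U n) <= delta%:E]].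

Definition hausdorff_measure (s : R) (E : set R) : \bar R :=
  ereal_sup [set hausdorff_content s delta E | delta in [set d | (0 < d)%R]].

Definition hausdorff_dim (E : set R) : \bar R :=
  ereal_inf [set s%:E | s in [set s | (0 <= s)%R /\ hausdorff_measure s E = 0]].

Definition hausdorff_dim_measure
    (nu : {measure set (measurableTypeR R) -> \bar R}) : \bar R :=
  ereal_inf [set hausdorff_dim E |
    E in [set E : set (measurableTypeR R) | measurable E /\ 0 < nu E]].

End hausdorff_dimension.

(* Main.v *)
Require Import Defs.
From HB Require Import structures.
From mathcomp Require Import all_boot all_order all_algebra.
From mathcomp Require Import all_classical all_reals all_analysis.
From mathcomp Require Import measurable_realfun.
From mathcomp Require Import complex.
From mathcomp Require Import ring lra zify.

(** For a set [S] of indices let [X_S] be the sum of [xi_i 2^-(i+1)] over [i] in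
    [S], where the [xi_i] are independent fair bits, and let [binlaw S] be the law
    of [X_S].  The random measure is [w |-> binlaw (ones w)]: the set [S] consists
    of the positions at which the sequence [w] has the letter 1.

    Spectrality, for every [S].  Independence gives [|hat(t)|^2 = lim_n P_n(t)]
    for the Fourier transform of [binlaw S], with [P_n] the product of
    [cos^2 (pi t / 2^(k+1))] over the [k < n] in [S] ([cosprod], [binlaw_fourier]).
    The frequencies are built one bit at a time: when [n] is in [S], every
    frequency [l] already present gets the companion [l + 2^n] or [l - 2^n], the
    sign being chosen against that of [l] ([wrap]).  Since [P_n] has period [2^n],
    induction shows that distinct frequencies differ by zeros of [P_n], so that
    their exponentials are orthogonal ([spectrum_orth]), and that the [P_n(t - l)]
    sum to 1 over the frequencies present at stage [n] ([spectrum_sum]).  The choice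
    of sign keeps these frequencies between [-2^(n-1)] and [2^(n-1)], so that the
    factors of index at least [n] do not come close to zero at them
    ([cosprod_tail_ge]); the limit can therefore be exchanged with the sum
    ([spectrum_total]).  By Bessel's
    identity every exponential, of any real frequency, lies in the closed span of
    the chosen ones.

    Totality of all exponentials holds for every probability measure on the line.
    The bounded functions that multiply exponentials into the closed span form an
    algebra closed under bounded pointwise limits ([multiplierM],
    [multiplier_lim]).  It contains [x |-> sin (c (x - y))], hence, after iterating
    the smoothstep polynomial and letting [c] tend to 0, the indicators of rays,
    hence all Borel indicators ([multiplier_indic]).

    Dimension.  If [S] has density [s > 0], then [2^(|S_n|)] intervals of length
    [2^-n] cover a set of full measure, and every such interval has mass at most
    [3 * 2^-(|S_n|)], where [S_n] is the part of [S] below [n]; so the dimension of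
    [binlaw S] is [s] by covering and by mass distribution ([binlaw_dim]).

    Randomness.  Give the letters 1 and 2 the probabilities [s] and [1 - s].  By the
    strong law of large numbers ([bernoulli_lln], from a Chernoff bound and
    Borel-Cantelli) the letter 1 has frequency [s] almost surely.  The fair bits and
    the Bernoulli measures are read off the digits of a uniform point of [[0, 1)] in
    the expansion whose first digit splits it at [p] ([cylE], [integral_digits]). *)

Set Implicit Arguments.
Unset Strict Implicit.
Unset Printing Implicit Defensive.

Import Order.TTheory GRing.Theory Num.Theory.
Import numFieldNormedType.Exports.
Import HBNNSimple.

Local Open Scope classical_set_scope.
Local Open Scope complex_scope.
Local Open Scope ring_scope.

(** * Cosine products and the spectrum *)

Section spectrum.
Context {R : realType}.
Implicit Types (S : nat -> bool) (n k : nat) (t u : R).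

Lemma cos2DpiMn (x : R) n : cos (x + pi *+ n) ^+ 2 = cos x ^+ 2.
Proof.
elim: n => [|n IH]; first by rewrite mulr0n addr0.
by rewrite mulrS addrCA addrC cosDpi sqrrN.
Qed.

Lemma sin_lipschitz (x y : R) : `|sin x - sin y| <= `|x - y|.
Proof.
wlog xy : x y / y <= x.
  move=> H; have [/H//|/ltW/H h] := leP y x.
  by rewrite distrC [leRHS]distrC.
have [|z _ ->] := @MVT_segment R sin cos y x xy.
  by apply: continuous_subspaceT => z; exact: continuous_sin.
rewrite normrM -[leRHS]mul1r ler_wpM2r ?normr_ge0//.
exact: cos_max.
Qed.

Lemma cos2_ge (x : R) : 1 - x ^+ 2 <= cos x ^+ 2.
Proof.
rewrite cos2sin2 lerD2l lerN2 -[_ ^+ 2]real_normK ?num_real//.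
rewrite -[leRHS]real_normK ?num_real// lerXn2r ?nnegrE//.
by have := sin_lipschitz x 0; rewrite sin0 !subr0.
Qed.

(** The squared modulus of the Fourier transform of the uniform law on the sums
    of [2^-(k+1)] over subsets of [S] below [n]. *)
Definition cosprod S n t : R :=
  \prod_(k < n | S k) cos (pi * t / 2 ^+ k.+1) ^+ 2.

Lemma cosprodS S n t : cosprod S n.+1 t =
  cosprod S n t * (if S n then cos (pi * t / 2 ^+ n.+1) ^+ 2 else 1).
Proof. by rewrite /cosprod big_mkcond big_ord_recr -big_mkcond. Qed.

Lemma cosprod_ge0 S n t : 0 <= cosprod S n t.
Proof. by apply: prodr_ge0 => k _; exact: sqr_ge0. Qed.

Lemma cos2_le1 (x : R) : cos x ^+ 2 <= 1.
Proof. by rewrite cos2sin2 lerBlDr lerDl sqr_ge0. Qed.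

Lemma cosprodS_le S n t : cosprod S n.+1 t <= cosprod S n t.
Proof.
rewrite cosprodS; case: (S n); rewrite ?mulr1//.
by rewrite -[leRHS]mulr1 ler_wpM2l ?cosprod_ge0 ?cos2_le1.
Qed.

Lemma cosprod_le1 S n t : cosprod S n t <= 1.
Proof.
elim: n => [|n IH]; first by rewrite /cosprod big_ord0.
exact: le_trans (cosprodS_le _ _ _) IH.
Qed.

Lemma cosprod_anti S t : nonincreasing_seq (cosprod S ^~ t).
Proof. by apply/nonincreasing_seqP => n; exact: cosprodS_le. Qed.

(** Shifting [t] by [2^n] shifts the angle of the factor of index [k < n] by the
    multiple [2^(n-k-1)] of [pi], and [cos^2] has period [pi]. *)
Lemma cosprod_periodic S n t : cosprod S n (t + 2 ^+ n) = cosprod S n t.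
Proof.
apply: eq_bigr => k _.
rewrite mulrDr mulrDl.
have -> : pi * 2 ^+ n / 2 ^+ k.+1 = pi *+ (2 ^ (n - k.+1)) :> R.
  have -> : 2 ^+ n = 2 ^+ (n - k.+1) * 2 ^+ k.+1 :> R by rewrite -exprD subnK.
  by rewrite mulrA mulfK ?expf_neq0// -[in RHS]mulr_natr natrX.
exact: cos2DpiMn.
Qed.

Lemma cosprod_periodicN S n t : cosprod S n (t - 2 ^+ n) = cosprod S n t.
Proof. by rewrite -[LHS]cosprod_periodic subrK. Qed.

(** The sign is chosen so that [wrap n] sends the two halves of an interval
    of length [2^n] centred at 0 to the two outer quarters of the interval twice
    as long; any choice would give orthogonality, this one keeps frequencies small. *)
Definition wrap n (l : R) : R := if 0 <= l then l - 2 ^+ n else l + 2 ^+ n.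

Fixpoint spectrum_upto S n : seq R :=
  if n is m.+1 then
    spectrum_upto S m ++ (if S m then map (wrap m) (spectrum_upto S m) else [::])
  else [:: 0].

Lemma cosprod_wrapr S n t l : cosprod S n (t - wrap n l) = cosprod S n (t - l).
Proof.
rewrite /wrap; case: ifP => _.
  by rewrite opprB addrA addrAC cosprod_periodic.
by rewrite opprD addrA cosprod_periodicN.
Qed.

Lemma cosprod_wrapl S n t l : cosprod S n (wrap n l - t) = cosprod S n (l - t).
Proof.
rewrite /wrap; case: ifP => _.
  by rewrite addrAC cosprod_periodicN.
by rewrite addrAC cosprod_periodic.
Qed.

Lemma spectrum_bound S n l : l \in spectrum_upto S n -> - 2 ^+ n <= l *+ 2 < 2 ^+ n.
Proof.
elim: n l => [|n IH] l /=.
  by rewrite inE => /eqP ->; rewrite mul0rn expr0 ltr01 oppr_le0 ler01.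
have p2 : 0 < 2 ^+ n :> R by rewrite exprn_gt0.
rewrite mem_cat => /orP[/IH|]; first by rewrite exprS => /andP[? ?]; lra.
case: (S n) => // /mapP[m /IH /andP[h1 h2] ->]; rewrite /wrap exprS.
by case: ifPn => h; [|rewrite -ltNge in h]; lra.
Qed.

(** The interval of [spectrum_bound] is half-open because at its left end [wrap]
    must still leave the interval. *)
Lemma wrap_notin S n l : l \in spectrum_upto S n -> wrap n l \notin spectrum_upto S n.
Proof.
move=> /spectrum_bound /andP[h1 h2]; apply/negP => /spectrum_bound.
by rewrite /wrap; case: ifPn => h; [|rewrite -ltNge in h]; move=> /andP[? ?]; lra.
Qed.

Lemma wrap_inj S n : {in spectrum_upto S n &, injective (wrap n)}.
Proof.
move=> x y /spectrum_bound /andP[x1 x2] /spectrum_bound /andP[y1 y2].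
have p2 : 0 < 2 ^+ n :> R by rewrite exprn_gt0.
rewrite /wrap; case: ifPn => hx; case: ifPn => hy; rewrite -?ltNge in hx hy *;
  lra.
Qed.

Lemma spectrum_uniq S n : uniq (spectrum_upto S n).
Proof.
elim: n => //= n IH; case: (S n); last by rewrite cats0.
rewrite cat_uniq IH map_inj_in_uniq ?IH ?andbT; last exact: (@wrap_inj S).
apply/hasPn => _ /mapP[l ls ->].
exact: wrap_notin.
Qed.

(** Passing from a frequency to its companion changes a difference by a multiple of
    [2^n], a period of the product; a frequency and its own companion differ by
    [2^n] up to sign, where the new factor is [cos^2 (pi / 2)]. *)
Lemma spectrum_orth S n x y : x \in spectrum_upto S n ->
  y \in spectrum_upto S n -> x != y ->
  cosprod S n (x - y) = 0.
Proof.
have cosNpi_half m : cos (pi * - 2 ^+ m / 2 ^+ m.+1) = 0 :> R.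
  by rewrite mulrN mulNr cosN exprS invfM mulrACA divff ?expf_neq0// mulr1 cos_pihalf.
have cospi_half m : cos (pi * 2 ^+ m / 2 ^+ m.+1) = 0 :> R.
  by rewrite exprS invfM mulrACA divff ?expf_neq0// mulr1 cos_pihalf.
elim: n x y => [|n IH] x y /=.
  by rewrite !inE => /eqP -> /eqP ->; rewrite eqxx.
rewrite !mem_cat cosprodS.
case Sn: (S n); last by rewrite mulr1 !orbF; exact: IH.
move=> /orP[xs|/mapP[x' xs ->]] /orP[ys|/mapP[y' ys ->]] xy.
- by rewrite IH// mul0r.
- rewrite cosprod_wrapr; have [<-|ne] := eqVneq x y'; last by rewrite IH// mul0r.
  rewrite /wrap; case: ifP => _.
    by rewrite opprB addrCA subrr addr0 cospi_half expr0n mulr0.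
  by rewrite opprD addrA subrr add0r cosNpi_half expr0n mulr0.
- rewrite cosprod_wrapl; have [<-|ne] := eqVneq x' y; last by rewrite IH// mul0r.
  rewrite /wrap; case: ifP => _.
    by rewrite addrAC subrr add0r cosNpi_half expr0n mulr0.
  by rewrite addrAC subrr add0r cospi_half expr0n mulr0.
- rewrite cosprod_wrapl cosprod_wrapr IH ?mul0r//.
  by apply: contra_neq xy => ->.
Qed.

(** A frequency and its companion see the same product of the first [n] factors,
    while their new factors are [cos^2] and [sin^2] of the same angle. *)
Lemma spectrum_sum S n t : \sum_(l <- spectrum_upto S n) cosprod S n (t - l) = 1.
Proof.
elim: n => [|n IH] /=.
  by rewrite big_seq1 /cosprod big_ord0.
rewrite big_cat /=; case Sn: (S n); last first.
  by rewrite big_nil addr0 -[RHS]IH; apply: eq_bigr => l _; rewrite cosprodS Sn mulr1.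
rewrite big_map -big_split /= -[RHS]IH; apply: eq_bigr => l _.
rewrite !cosprodS Sn cosprod_wrapr -mulrDr.
suff -> : cos (pi * (t - wrap n l) / 2 ^+ n.+1) ^+ 2 =
          sin (pi * (t - l) / 2 ^+ n.+1) ^+ 2 by rewrite cos2Dsin2 mulr1.
have e : pi * 2 ^+ n / 2 ^+ n.+1 = pi / 2 :> R.
  by rewrite exprS invfM mulrACA divff ?expf_neq0// mulr1.
rewrite /wrap; case: ifP => _.
  rewrite opprB addrA addrAC mulrDr mulrDl e cosDpihalf.
  by rewrite sqrrN.
by rewrite opprD addrA mulrBr mulrBl e cosBpihalf.
Qed.

(** Lower bound for all factors of index at least [n] when
    [|u| <= (3/4) 2^n]: the first is at least [cos^2 (3 pi / 8)], the product of the
    others at least [1/4]. *)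
Definition tail_const : R := cos (3 / 8 * pi) ^+ 2 * 4^-1.

Lemma tail_const_gt0 : 0 < tail_const.
Proof.
rewrite mulr_gt0 ?invr_gt0// exprn_gt0//; apply: cos_gt0_pihalf.
by have := pi_gt0 R => ?; lra.
Qed.

Lemma cos2_mono (x : R) : `|x| <= 3 / 8 * pi -> cos (3 / 8 * pi) ^+ 2 <= cos x ^+ 2.
Proof.
have pi0 := pi_gt0 R.
move=> hx; rewrite -(cos_norm x) lerXn2r ?nnegrE ?cos_ge0_pihalf//.
- by lra.
- by have := normr_ge0 x => ?; lra.
rewrite le_eqVlt; have [->|ne] := eqVneq `|x| (3 / 8 * pi); first by rewrite eqxx.
apply/orP; right; rewrite ltr_cos ?in_itv/= ?normr_ge0/=; [|lra|lra].
by rewrite lt_neqAle ne.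
Qed.

(** The angles of the factors of index [n+1, n+2, ...] decrease geometrically, so
    [cos^2 x >= 1 - x^2] bounds their product from below by 1 minus a convergent
    geometric series. *)
Lemma cosprod_tail_ge S n N u : `|u| <= 3 / 4 * 2 ^+ n -> (n <= N)%N ->
  tail_const * cosprod S n u <= cosprod S N u.
Proof.
move=> hu nN.
have pi0 := pi_gt0 R.
have p2 m : 0 < 2 ^+ m :> R by rewrite exprn_gt0.
have npi : `|pi| = pi :> R by rewrite gtr0_norm.
have first_factor : cos (3 / 8 * pi) ^+ 2 * cosprod S n u <= cosprod S n.+1 u.
  rewrite cosprodS mulrC ler_wpM2l ?cosprod_ge0//.
  case: ifP => _; last exact: cos2_le1.
  apply: cos2_mono; rewrite !normrM normfV npi (gtr0_norm (p2 _)) exprS invfM.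
  have : pi * `|u| <= pi * (3 / 4 * 2 ^+ n) by rewrite ler_wpM2l ?(ltW pi0).
  move=> h; rewrite mulrA ler_pdivrMr//; lra.
(* Invariant: after [j] further factors the loss is at most [(3/4) (1 - 4^-j)]. *)
have key j : cosprod S n.+1 u * (4^-1 + 3 / 4 * 4^-1 ^+ j) <= cosprod S (n.+1 + j) u.
  elim: j => [|j IH].
    by rewrite addn0 expr0 mulr1 -[leRHS]mulr1 ler_wpM2l ?cosprod_ge0//; lra.
  rewrite addnS [leRHS]cosprodS; case: ifP => _; last first.
    rewrite mulr1; apply: le_trans IH; rewrite ler_wpM2l ?cosprod_ge0//.
    rewrite exprS; have : 0 <= 4^-1 ^+ j :> R by rewrite exprn_ge0//.
    by move=> ?; lra.
  set y := pi * u / _.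
  have hy : y ^+ 2 <= 9 / 16 * 4^-1 ^+ j.
    have -> : 9 / 16 * 4^-1 ^+ j = (3 / 4 * 2^-1 ^+ j) ^+ 2 :> R.
      by rewrite exprMn -exprM mulnC exprM; congr (_ * _ ^+ _); field.
    have h0 : 0 <= 3 / 4 * 2^-1 ^+ j :> R by rewrite mulr_ge0// exprn_ge0.
    rewrite -[leLHS]real_normK ?num_real// lerXn2r ?nnegrE//.
    rewrite /y !normrM normfV npi (gtr0_norm (p2 _)) ler_pdivrMr//.
    rewrite -addnS addSn -addnS exprD exprVn !exprS.
    have -> : 3 / 4 / 2 ^+ j * (2 ^+ n * (2 * (2 * 2 ^+ j))) = 3 * 2 ^+ n :> R.
      by field; rewrite expf_neq0.
    (* As [pi <= 4], the angle [y] is at most [(3/4) 2^-j]: a factor costs [(9/16) 4^-j]. *)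
    have pi4 : pi <= 4 :> R.
      by have /andP[_] := @pihalf_02 R => ?; lra.
    apply: le_trans (_ : 4 * `|u| <= _); first by rewrite ler_wpM2r.
    lra.
  have c2 := cos2_ge y.
  have P1 := cosprod_le1 S (n.+1 + j) u.
  have P0 := cosprod_ge0 S (n.+1 + j) u.
  have Q0 := cosprod_ge0 S n.+1 u.
  have Q1 : cosprod S (n.+1 + j) u <= cosprod S n.+1 u.
    by apply: cosprod_anti; rewrite leq_addr.
  apply: le_trans (_ : cosprod S (n.+1 + j) u * (1 - y ^+ 2) <= _); last first.
    by rewrite ler_wpM2l.
  rewrite mulrBr mulr1.
  apply: le_trans (_ : cosprod S (n.+1 + j) u -
    cosprod S n.+1 u * (9 / 16 * 4^-1 ^+ j) <= _); last first.
    by rewrite lerD2l lerN2 ler_pM// sqr_ge0.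
  rewrite lerBrDr; apply: le_trans IH; rewrite -mulrDr ler_wpM2l//.
  by rewrite exprS; have : 0 <= 4^-1 ^+ j :> R by [rewrite exprn_ge0]; lra.
rewrite /tail_const mulrAC; case: (ltngtP n N) nN => // [nN _|<- _].
  rewrite -(subnKC nN); apply: le_trans (key _).
  have : 0 <= 4^-1 ^+ (N - n.+1) :> R by rewrite exprn_ge0.
  move=> h; apply: ler_pM => //; first by rewrite mulr_ge0 ?sqr_ge0 ?cosprod_ge0.
  lra.
rewrite -[leRHS]mul1r mulrAC ler_wpM2r ?cosprod_ge0//.
by have := cos2_le1 (3 / 8 * pi); lra.
Qed.

Lemma spectrum_prefix S m n : (m <= n)%N ->
  exists r, spectrum_upto S n = spectrum_upto S m ++ r.
Proof.
move=> mn; rewrite -(subnKC mn); elim: (n - m)%N => [|j [r IH]].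
  by exists [::]; rewrite addn0 cats0.
by rewrite addnS /= IH; eexists; rewrite -catA; reflexivity.
Qed.

(** The defect at stage [m] is controlled by the mass that [G] still gains after
    [m]: the terms at stage [n > m] that are new since [m] are at most
    [1 / tail_const] times their limits, and those limits are a tail of a convergent
    sum. *)
Lemma spectrum_total S (G : R -> R) t (eps : R) :
  (forall u, cosprod S n u @[n --> \oo] --> G u) -> 0 < eps ->
  exists n, 1 - eps < \sum_(l <- spectrum_upto S n) G (t - l).
Proof.
move=> PG eps0.
have GP n u : G u <= cosprod S n u.
  rewrite -(cvg_lim _ (PG u))//; apply: nonincreasing_cvgn_ge.
    exact: cosprod_anti.
  by apply/cvg_ex; exists (G u).
have G0 u : 0 <= G u.
  rewrite -(cvg_lim _ (PG u))//; apply: limr_ge.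
    by apply/cvg_ex; exists (G u).
  by apply: nearW => n; exact: cosprod_ge0.
pose F n := \sum_(l <- spectrum_upto S n) G (t - l).
have F1 n : F n <= 1 by rewrite -(spectrum_sum S n t); apply: ler_sum.
have Fnd : nondecreasing_seq F.
  apply/nondecreasing_seqP => n; have [r er] := spectrum_prefix S (leqnSn n).
  by rewrite /F er big_cat lerDl sumr_ge0.
have Fcvg : cvgn F.
  by apply: nondecreasing_is_cvgn => //; exists 1 => _ [n _ <-].
pose L := limn F.
have FL n : F n <= L by exact: nondecreasing_cvgn_le.
(* From here on [|t| <= 2^m / 4] and [|l| <= 2^m / 2] give [|t - l| <= (3/4) 2^m]. *)
have [m0 hm0] : exists m0, forall m, (m0 <= m)%N -> `|t| * 4 <= 2 ^+ m.
  exists (Num.bound (`|t| * 4)) => m hm.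
  apply: le_trans (_ : m%:R <= _); last first.
    by rewrite -natrX ler_nat ltnW// ltn_expl.
  apply/ltW; apply: lt_le_trans (archi_boundP _) _; first by rewrite mulr_ge0.
  by rewrite ler_nat.
have key m : (m0 <= m)%N -> tail_const * (1 - F m) <= L - F m.
  move=> hm.
  have low n : (m <= n)%N ->
      tail_const * (1 - \sum_(l <- spectrum_upto S m) cosprod S n (t - l)) <= L - F m.
    move=> mn; have [r er] := spectrum_prefix S mn.
    rewrite -(spectrum_sum S n t) er big_cat /= addrAC subrr add0r.
    apply: le_trans (_ : F n - F m <= _); last by rewrite lerD2r.
    rewrite /F er big_cat /= addrAC subrr add0r mulr_sumr.
    rewrite [leLHS]big_seq_cond [leRHS]big_seq_cond; apply: ler_sum => l.
    rewrite andbT => lr.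
    rewrite -(cvg_lim _ (PG (t - l)))//; apply: limr_ge.
      by apply/cvg_ex; exists (G (t - l)).
    near=> N; apply: cosprod_tail_ge; last by near: N; exact: nbhs_infty_ge.
    have /spectrum_bound /andP[l1 l2] : l \in spectrum_upto S n.
      by rewrite er mem_cat lr orbT.
    have h1 := hm0 _ (leq_trans hm mn).
    apply: le_trans (_ : `|t| + `|l| <= _); first exact: ler_normB.
    have : `|l| *+ 2 <= 2 ^+ n by rewrite -normrMn ler_norml l1 ltW.
    lra.
  have : tail_const * (1 - \sum_(l <- spectrum_upto S m) cosprod S n (t - l))
      @[n --> \oo] -->
         tail_const * (1 - F m).
    apply: cvgM; first exact: cvg_cst.
    apply: cvgB; first exact: cvg_cst.
    rewrite /F; elim: (spectrum_upto S m) => [|l r IH].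
      by under eq_fun do rewrite big_nil; rewrite big_nil; exact: cvg_cst.
    by under eq_fun do rewrite big_cons; rewrite big_cons; apply: cvgD.
  move=> c; rewrite -(cvg_lim _ c)//; apply: limr_le.
    by apply/cvg_ex; eexists; exact: c.
  by near=> n; apply: low; near: n; exact: nbhs_infty_ge.
have : L - F m @[m --> \oo] --> L - L by apply: cvgB => //; exact: cvg_cst.
rewrite subrr => /cvgrPdist_lt /(_ (tail_const * eps)).
rewrite mulr_gt0 ?tail_const_gt0// => /(_ isT) [m1 _ hm1].
exists (maxn m0 m1).
have := hm1 (maxn m0 m1); rewrite /= leq_maxr sub0r normrN => /(_ isT).
rewrite ger0_norm ?subr_ge0// => h.
have := le_lt_trans (key _ (leq_maxl m0 m1)) h.
by rewrite ltr_pM2l ?tail_const_gt0// /F => ?; lra.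
Unshelve. all: by end_near. Qed.

End spectrum.

(** * Complex functions and the square of the L2 norm *)

Section complex_aux.
Context {R : realType}.
Implicit Types (z w : R[i]).

Lemma sqr_normcE z :
  Normc.normc z ^+ 2 = complex.Re z ^+ 2 + complex.Im z ^+ 2.
Proof. by case: z => a b /=; rewrite sqr_sqrtr// addr_ge0 ?sqr_ge0. Qed.

Lemma sqr_normcD z w :
  Normc.normc (z + w) ^+ 2 <= 2 * Normc.normc z ^+ 2 + 2 * Normc.normc w ^+ 2.
Proof.
rewrite !sqr_normcE; case: z w => [a b] [c d] /=.
by have := sqr_ge0 (a - c); have := sqr_ge0 (b - d); nra.
Qed.

Lemma sqr_normcM z w :
  Normc.normc (z * w) ^+ 2 = Normc.normc z ^+ 2 * Normc.normc w ^+ 2.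
Proof. by rewrite Normc.normcM exprMn. Qed.

Lemma sqr_normcR (x : R) : Normc.normc x%:C ^+ 2 = x ^+ 2.
Proof. by rewrite sqr_normcE /= expr0n addr0. Qed.

Lemma sqr_normc_fourier (t x : R) : Normc.normc (fourier_exp t x) ^+ 2 = 1.
Proof. by rewrite sqr_normcE cos2Dsin2. Qed.

Lemma fourier_expD (s t x : R) :
  fourier_exp (s + t) x = fourier_exp s x * fourier_exp t x.
Proof.
rewrite /fourier_exp mulrDr mulrDl cosD sinD /=.
by apply/eqP; rewrite eq_complex /=; apply/andP; split; apply/eqP => //; ring.
Qed.

Lemma fourier_expDx (t x y : R) :
  fourier_exp t (x + y) = fourier_exp t x * fourier_exp t y.
Proof.
rewrite /fourier_exp mulrDr cosD sinD /=.
by apply/eqP; rewrite eq_complex /=; apply/andP; split; apply/eqP => //; ring.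
Qed.

End complex_aux.

Section complex_measurable.
Context {R : realType} {d} {T : measurableType d}.
Implicit Types f g : T -> R[i].

Definition cmeasurable f : Prop :=
  measurable_fun setT (fun x => complex.Re (f x)) /\
  measurable_fun setT (fun x => complex.Im (f x)).

Lemma cmeasurableD f g : cmeasurable f -> cmeasurable g ->
  cmeasurable (fun x => f x + g x).
Proof.
move=> [f1 f2] [g1 g2]; split.
  apply: eq_measurable_fun (measurable_funD f1 g1) => x _ /=.
  by case: (f x) (g x) => ? ? [].
apply: eq_measurable_fun (measurable_funD f2 g2) => x _ /=.
by case: (f x) (g x) => ? ? [].
Qed.

Lemma cmeasurableM f g : cmeasurable f -> cmeasurable g ->
  cmeasurable (fun x => f x * g x).
Proof.
move=> [f1 f2] [g1 g2]; split.
  apply: eq_measurable_fun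
    (measurable_funB (measurable_funM f1 g1) (measurable_funM f2 g2)) => x _ /=.
  by case: (f x) (g x) => ? ? [].
apply: eq_measurable_fun
  (measurable_funD (measurable_funM f1 g2) (measurable_funM f2 g1)) => x _ /=.
by case: (f x) (g x) => ? ? [].
Qed.

Lemma cmeasurableN f : cmeasurable f -> cmeasurable (fun x => - f x).
Proof.
move=> [f1 f2]; split.
  apply: eq_measurable_fun (measurable_funN f1) => x _ /=.
  by case: (f x).
apply: eq_measurable_fun (measurable_funN f2) => x _ /=.
by case: (f x).
Qed.

Lemma cmeasurableB f g : cmeasurable f -> cmeasurable g ->
  cmeasurable (fun x => f x - g x).
Proof. by move=> mf mg; apply: cmeasurableD => //; exact: cmeasurableN. Qed.

Lemma cmeasurable_cst (z : R[i]) : cmeasurable (fun _ => z).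
Proof. by split; exact: measurable_cst. Qed.

Lemma cmeasurable_real (h : T -> R) : measurable_fun setT h ->
  cmeasurable (fun x => (h x)%:C).
Proof. by move=> mh; split => //=; exact: measurable_cst. Qed.

Lemma cmeasurable_sum (I : Type) (s : seq I) (F : I -> T -> R[i]) :
  (forall i, cmeasurable (F i)) -> cmeasurable (fun x => \sum_(i <- s) F i x).
Proof.
move=> mF; elim: s => [|i s IH].
  by under eq_fun do rewrite big_nil; exact: cmeasurable_cst.
by under eq_fun do rewrite big_cons; apply: cmeasurableD.
Qed.

Lemma measurable_sqr_normc f : cmeasurable f ->
  measurable_fun setT (fun x => Normc.normc (f x) ^+ 2).
Proof.
move=> [f1 f2]; under eq_fun do rewrite sqr_normcE.
by apply: measurable_funD; exact: measurable_funX.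
Qed.

End complex_measurable.

Lemma measurable_cos_lin (R : realType) (a : R) :
  measurable_fun [set: measurableTypeR R] (fun x : R => cos (a * x)).
Proof.
apply: (measurableT_comp (f := cos)); last exact: mulrl_measurable.
by apply: continuous_measurable_fun => x; exact: continuous_cos.
Qed.

Lemma measurable_sin_lin (R : realType) (a : R) :
  measurable_fun [set: measurableTypeR R] (fun x : R => sin (a * x)).
Proof.
apply: (measurableT_comp (f := sin)); last exact: mulrl_measurable.
by apply: continuous_measurable_fun => x; exact: continuous_sin.
Qed.

Lemma cmeasurable_fourier (R : realType) (t : R) :
  cmeasurable (T := measurableTypeR R) (fourier_exp t).
Proof.
by split; [exact: measurable_cos_lin|exact: measurable_sin_lin].
Qed.

Section L2norm.
Context {R : realType} (nu : {measure set (measurableTypeR R) -> \bar R}).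
Implicit Types f g : R -> R[i].
Local Notation cmeas := (cmeasurable (T := measurableTypeR R)).

Definition sqL2 f : \bar R := \int[nu]_x (Normc.normc (f x) ^+ 2)%:E.

Lemma measurable_sqL2 f : cmeas f ->
  measurable_fun [set: measurableTypeR R]
    (fun x => (Normc.normc (f x) ^+ 2)%:E).
Proof. by move=> mf; apply/measurable_EFinP; exact: measurable_sqr_normc. Qed.

Lemma sqL2D f g : cmeas f -> cmeas g ->
  (sqL2 (fun x => f x + g x)%R <= 2%:E * sqL2 f + 2%:E * sqL2 g)%E.
Proof.
move=> mf mg.
have n0 (h : R -> R[i]) (x : measurableTypeR R) : [set: measurableTypeR R] x ->
    (0 <= (Normc.normc (h x) ^+ 2)%:E)%E by rewrite lee_fin sqr_ge0.
have n02 (h : R -> R[i]) (x : measurableTypeR R) : [set: measurableTypeR R] x ->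
    (0 <= 2%:E * (Normc.normc (h x) ^+ 2)%:E)%E.
  by rewrite -EFinM lee_fin mulr_ge0// sqr_ge0.
have m2 (h : R -> R[i]) : cmeas h -> measurable_fun [set: measurableTypeR R]
    (fun x => 2%:E * (Normc.normc (h x) ^+ 2)%:E)%E.
  by move=> mh; apply: measurable_funeM; exact: measurable_sqL2.
rewrite /sqL2 -!ge0_integralZl_EFin//; try by [exact: n0|exact: measurable_sqL2].
rewrite -ge0_integralD//; try by [exact: n02|exact: m2].
apply: ge0_le_integral => //.
- exact: n0.
- by apply: measurable_sqL2; exact: cmeasurableD.
- by apply: emeasurable_funD; exact: m2.
- by move=> x _; rewrite -!EFinM -EFinD lee_fin sqr_normcD.
Qed.

Lemma sqL2M_le (M : R) f g : cmeas f -> cmeas g -> 0 <= M ->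
  (forall x, Normc.normc (f x) ^+ 2 <= M) ->
  (sqL2 (fun x => f x * g x)%R <= M%:E * sqL2 g)%E.
Proof.
move=> mf mg M0 fM.
have n0 (h : R -> R[i]) (x : measurableTypeR R) : [set: measurableTypeR R] x ->
    (0 <= (Normc.normc (h x) ^+ 2)%:E)%E by rewrite lee_fin sqr_ge0.
rewrite /sqL2 -ge0_integralZl_EFin//; try by [exact: n0|exact: measurable_sqL2].
apply: ge0_le_integral => //.
- exact: n0.
- by apply: measurable_sqL2; exact: cmeasurableM.
- by apply: measurable_funeM; exact: measurable_sqL2.
- by move=> x _; rewrite -EFinM lee_fin sqr_normcM ler_wpM2r ?sqr_ge0.
Qed.

Lemma sqL2_cvg0 (u : nat -> R -> R[i]) (G : R -> R) :
  (forall n, cmeas (u n)) ->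
  nu.-integrable setT (EFin \o G) ->
  (forall n x, Normc.normc (u n x) ^+ 2 <= G x) ->
  (forall x, Normc.normc (u n x) ^+ 2 @[n --> \oo] --> (0 : R)) ->
  forall eps : R, 0 < eps -> exists n, (sqL2 (u n) < eps%:E)%E.
Proof.
move=> mu_ iG uG u0 eps eps0.
have n0 n (x : measurableTypeR R) : [set: measurableTypeR R] x ->
    (0 <= (Normc.normc (u n x) ^+ 2)%:E)%E by rewrite lee_fin sqr_ge0.
have : (\int[nu]_x (Normc.normc (u n x) ^+ 2)%:E @[n --> \oo] -->
        \int[nu]_(x in [set: measurableTypeR R]) (cst 0%E) x)%E.
  apply: (@dominated_cvg _ _ _ nu setT measurableT
    (fun n x => (Normc.normc (u n x) ^+ 2)%:E) (cst 0%E) (EFin \o G)) => //.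
  - by move=> n; exact: measurable_sqL2.
  - by move=> x _; apply: cvg_EFin; [exact: nearW|exact: u0].
  - by move=> n x _ /=; rewrite lee_fin ger0_norm ?sqr_ge0.
rewrite integral0 => /fine_cvgP[fin /cvgrPdist_lt /(_ _ eps0) H].
have [n [fn hn]] : exists n, sqL2 (u n) \is a fin_num /\
   `|0 - fine (sqL2 (u n))| < eps.
  by have [n _ /(_ n (leqnn n))] := filterI fin H; exists n.
exists n; rewrite -(fineK fn) lte_fin; apply: le_lt_trans hn.
by rewrite sub0r normrN ler_norm.
Qed.

End L2norm.

(** * The closed span of a family of exponentials *)

Section closed_span.
Context {R : realType} (nu : {measure set (measurableTypeR R) -> \bar R}).
Hypothesis nu1 : nu [set: R] = 1%E.
Variable (D : set R).
Implicit Types (f g : R -> R[i]) (h : R -> R).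
Local Notation cmeas := (cmeasurable (T := measurableTypeR R)).

Definition trigsum (l : seq (R * R[i])) (x : R) : R[i] :=
  \sum_(p <- l) p.2 * fourier_exp p.1 x.

(** Approximants are lists of pairs (frequency, coefficient) that may repeat a
    frequency, so that sums of approximants are concatenations; [trigsum_undup]
    recovers distinct frequencies. *)
Definition inspan f : Prop := cmeas f /\
  forall eps : R, 0 < eps -> exists l : seq (R * R[i]),
    (forall p, p \in l -> D p.1) /\
    (sqL2 nu (fun x => f x - trigsum l x)%R < eps%:E)%E.

Lemma cmeasurable_trigsum l : cmeas (trigsum l).
Proof.
apply: cmeasurable_sum => p; apply: cmeasurableM; first exact: cmeasurable_cst.
exact: cmeasurable_fourier.
Qed.

Lemma sqL2_0 : sqL2 nu (fun _ => 0) = 0%E.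
Proof.
rewrite /sqL2; under eq_integral do rewrite Normc.normc0 expr0n /=.
exact: integral0.
Qed.

Lemma inspan_lim f : cmeas f ->
  (forall eps : R, 0 < eps ->
    exists g, inspan g /\ (sqL2 nu (fun x => f x - g x)%R < eps%:E)%E) ->
  inspan f.
Proof.
move=> mf H; split=> // eps eps0.
have e4 : 0 < eps / 4 by rewrite divr_gt0.
have [g [[mg /(_ _ e4) [l [lD hl]]] hg]] := H _ e4.
exists l; split => //.
have -> : (fun x => f x - trigsum l x) =
          (fun x => (f x - g x) + (g x - trigsum l x)).
  by apply/funext => x; rewrite addrA subrK.
apply: le_lt_trans (sqL2D nu _ _) _.
- exact: cmeasurableB.
- by apply: cmeasurableB => //; exact: cmeasurable_trigsum.
have -> : eps%:E = (2%:E * (eps / 4)%:E + 2%:E * (eps / 4)%:E)%E.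
  by rewrite -!EFinM -EFinD; congr EFin; field.
by apply: lteD; rewrite lte_pmul2l// fin_numE.
Qed.

Lemma inspan_trigsum l : (forall p, p \in l -> D p.1) -> inspan (trigsum l).
Proof.
move=> lD; split; first exact: cmeasurable_trigsum.
move=> eps eps0; exists l; split => //.
by under eq_fun do rewrite subrr; rewrite sqL2_0 lte_fin.
Qed.

Lemma inspan0 : inspan (fun _ => 0).
Proof.
have -> : (fun _ => 0) = trigsum [::] by apply/funext => x; rewrite /trigsum big_nil.
exact: inspan_trigsum.
Qed.

Lemma inspanD f g : inspan f -> inspan g -> inspan (fun x => f x + g x).
Proof.
move=> [mf Hf] [mg Hg]; split; first exact: cmeasurableD.
move=> eps eps0.
have e4 : 0 < eps / 4 by rewrite divr_gt0.
have [l [lD hl]] := Hf _ e4; have [k [kD hk]] := Hg _ e4.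
exists (l ++ k); split.
  by move=> p; rewrite mem_cat => /orP[/lD|/kD].
have -> : (fun x => f x + g x - trigsum (l ++ k) x) =
          (fun x => (f x - trigsum l x) + (g x - trigsum k x)).
  by apply/funext => x; rewrite /trigsum big_cat opprD addrACA.
apply: le_lt_trans (sqL2D nu _ _) _.
- by apply: cmeasurableB => //; exact: cmeasurable_trigsum.
- by apply: cmeasurableB => //; exact: cmeasurable_trigsum.
have -> : eps%:E = (2%:E * (eps / 4)%:E + 2%:E * (eps / 4)%:E)%E.
  by rewrite -!EFinM -EFinD; congr EFin; field.
by apply: lteD; rewrite lte_pmul2l// fin_numE.
Qed.

Lemma inspanZ (c : R[i]) f : inspan f -> inspan (fun x => c * f x).
Proof.
move=> [mf Hf]; split.
  by apply: cmeasurableM => //; exact: cmeasurable_cst.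
move=> eps eps0.
pose M := Normc.normc c ^+ 2 + 1.
have M0 : 0 < M by rewrite ltr_pwDr// sqr_ge0.
have e4 : 0 < eps / M by rewrite divr_gt0.
have [l [lD hl]] := Hf _ e4.
exists [seq (p.1, c * p.2) | p <- l]; split.
  by move=> _ /mapP[p /lD ? ->].
have -> : (fun x => c * f x - trigsum [seq (p.1, c * p.2) | p <- l] x) =
          (fun x => c * (f x - trigsum l x)).
  apply/funext => x; rewrite /trigsum big_map mulrBr mulr_sumr.
  by congr (_ - _); apply: eq_bigr => p _; rewrite mulrA.
apply: le_lt_trans (sqL2M_le nu (M := M) _ _ _ _) _.
- exact: cmeasurable_cst.
- by apply: cmeasurableB => //; exact: cmeasurable_trigsum.
- exact: ltW.
- by move=> x; rewrite lerDl.
have -> : eps%:E = (M%:E * (eps / M)%:E)%E.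
  by rewrite -EFinM mulrCA divff ?gt_eqF// mulr1.
by rewrite lte_pmul2l// fin_numE.
Qed.

Lemma inspan_sum (I : Type) (s : seq I) (F : I -> R -> R[i]) :
  (forall i, inspan (F i)) -> inspan (fun x => \sum_(i <- s) F i x).
Proof.
move=> HF; elim: s => [|i s IH].
  by under eq_fun do rewrite big_nil; exact: inspan0.
by under eq_fun do rewrite big_cons; exact: inspanD.
Qed.

(** A multiplier sends the exponentials, and therefore their whole closed span, into
    the closed span. *)
Definition multiplier h : Prop :=
  [/\ measurable_fun [set: measurableTypeR R] h,
      exists M, forall x, `|h x| <= M &
      forall t, inspan (fun x => (h x)%:C * fourier_exp t x)].

Hypothesis exp_inspan : forall t, inspan (fourier_exp t).

Lemma multiplier_cst (a : R) : multiplier (fun _ => a).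
Proof.
split; [exact: measurable_cst| by exists `|a| |].
by move=> t; exact: inspanZ.
Qed.

Lemma multiplierD h k : multiplier h -> multiplier k ->
  multiplier (fun x => h x + k x).
Proof.
move=> [mh [M hM] H] [mk [N kN] K]; split; first exact: measurable_funD.
  by exists (M + N) => x; apply: le_trans (ler_normD _ _) _; exact: lerD.
move=> t; have := inspanD (H t) (K t).
congr inspan; apply/funext => x; rewrite -mulrDl; congr (_ * _).
by apply/eqP; rewrite eq_complex /= addr0 !eqxx.
Qed.

(** Approximate [k] times an exponential by a combination of exponentials of the
    family: multiplying by the bounded [h] enlarges the error by a bounded factor,
    and sends the combination into the span because [h] is a multiplier. *)
Lemma multiplierM h k : multiplier h -> multiplier k ->
  multiplier (fun x => h x * k x).
Proof.
move=> [mh [M hM] H] [mk [N kN] K]; split; first exact: measurable_funM.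
  by exists (M * N) => x; rewrite normrM ler_pM.
move=> t; apply: inspan_lim.
  by apply: cmeasurableM; [apply: cmeasurable_real; exact: measurable_funM|
    exact: cmeasurable_fourier].
move=> eps eps0.
pose B := M ^+ 2 + 1.
have B0 : 0 < B by rewrite ltr_pwDr// sqr_ge0.
have e4 : 0 < eps / B by rewrite divr_gt0.
have [mKt /(_ _ e4) [l [lD hl]]] := K t.
exists (fun x => (h x)%:C * trigsum l x); split.
  rewrite /trigsum; under eq_fun do rewrite mulr_sumr.
  apply: inspan_sum => p.
  under eq_fun do rewrite mulrCA.
  exact: inspanZ.
have -> : (fun x => (h x * k x)%:C * fourier_exp t x - (h x)%:C * trigsum l x) =
   (fun x => (h x)%:C * ((k x)%:C * fourier_exp t x - trigsum l x)).
  by apply/funext => x; rewrite mulrBr mulrA -rmorphM.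
apply: le_lt_trans (sqL2M_le nu (M := B) _ _ _ _) _.
- exact: cmeasurable_real.
- by apply: cmeasurableB => //; exact: cmeasurable_trigsum.
- exact: ltW.
- move=> x; rewrite sqr_normcR -real_normK ?num_real//.
  apply: le_trans (_ : M ^+ 2 <= _); last by rewrite lerDl.
  by rewrite lerXn2r ?nnegrE// (le_trans _ (hM x)).
have -> : eps%:E = (B%:E * (eps / B)%:E)%E.
  by rewrite -EFinM mulrCA divff ?gt_eqF// mulr1.
by rewrite lte_pmul2l// fin_numE.
Qed.

Lemma integrable_cstR (M : R) : nu.-integrable [set: measurableTypeR R] (EFin \o cst M).
Proof.
apply: measurable_bounded_integrable => //; first by rewrite nu1 ltry.
exists `|M|; split; first exact: num_real.
by move=> y My x _ /=; exact: ltW.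
Qed.

(** Dominated convergence: the domination is by a constant, integrable for a
    probability measure. *)
Lemma multiplier_lim (M : R) (u : nat -> R -> R) h :
  (forall n, multiplier (u n)) -> (forall n x, `|u n x| <= M) ->
  (forall x, u n x @[n --> \oo] --> h x) -> multiplier h.
Proof.
move=> Hu uM uh.
have mh : measurable_fun [set: measurableTypeR R] h.
  apply: (measurable_fun_cvg (h := u)) => [n|x _]; first by case: (Hu n).
  exact: uh.
have hM x : `|h x| <= M.
  have c : `|u n x| @[n --> \oo] --> `|h x| by apply: cvg_norm; exact: uh.
  rewrite -(cvg_lim _ c)//; apply: limr_le; first by apply/cvg_ex; eexists; exact: c.
  by apply: nearW => n; exact: uM.
split => //; first by exists M.
move=> t; apply: inspan_lim.
  by apply: cmeasurableM; [exact: cmeasurable_real|exact: cmeasurable_fourier].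
move=> eps eps0.
have [|||||n hn] := @sqL2_cvg0 _ nu (fun n x => (h x - u n x)%:C * fourier_exp t x)
   (cst ((M + M) ^+ 2)) _ _ _ _ eps.
- move=> n; apply: cmeasurableM; last exact: cmeasurable_fourier.
  by apply: cmeasurable_real; apply: measurable_funB => //; case: (Hu n).
- exact: integrable_cstR.
- move=> n x; rewrite sqr_normcM sqr_normc_fourier mulr1 sqr_normcR.
  rewrite -[leLHS]real_normK ?num_real// lerXn2r ?nnegrE//.
    by rewrite addr_ge0// (le_trans _ (hM 0)).
  by apply: le_trans (ler_normB _ _) _; exact: lerD.
- move=> x; under eq_fun do rewrite sqr_normcM sqr_normc_fourier mulr1 sqr_normcR.
  have c : h x - u n x @[n --> \oo] --> h x - h x.
    by apply: cvgB; [exact: cvg_cst|exact: uh].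
  under eq_fun do rewrite expr2.
  rewrite subrr in c.
  by rewrite -[X in nbhs X](mulr0 0) => A; exact: (cvgM c c).
- by [].
exists (fun x => (u n x)%:C * fourier_exp t x); split; first by case: (Hu n).
move: hn; congr (sqL2 _ _ < _)%E; apply/funext => x.
by rewrite -mulrBl -rmorphB.
Qed.

End closed_span.

(** * Multipliers of the closed span: indicators of Borel sets *)

Section smoothstep.
Context {R : realType}.
Implicit Types v : R.

(** Its iterates converge on [[0, 1]] to a step at [1/2], which turns polynomial
    expressions in a multiplier into indicators of its level sets. *)
Definition smoothstep v : R := v * v * (3 - 2 * v).

Lemma smoothstep_itv v : 0 <= v <= 1 -> 0 <= smoothstep v <= 1.
Proof.
rewrite /smoothstep => /andP[v0 v1]; apply/andP; split.
  by rewrite mulr_ge0 ?mulr_ge0//; lra.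
rewrite -subr_ge0.
have -> : 1 - v * v * (3 - 2 * v) = (1 - v) ^+ 2 * (1 + 2 * v) by ring.
by rewrite mulr_ge0 ?sqr_ge0//; lra.
Qed.

Lemma iter_smoothstep_itv n v : 0 <= v <= 1 -> 0 <= iter n smoothstep v <= 1.
Proof. by move=> ?; elim: n => //= n; exact: smoothstep_itv. Qed.

Lemma iter_smoothstep_gt v : 2^-1 < v <= 1 ->
  iter n smoothstep v @[n --> \oo] --> (1 : R).
Proof.
move=> /andP[v2 v1].
(* [1 - smoothstep w = (1 - w) (1 - w (2 w - 1))]; the last factor decreases for [w >= 1/2]. *)
pose r := 1 - v * (2 * v - 1).
have r01 : 0 <= r < 1 by rewrite /r; apply/andP; split; nra.
have key n : v <= iter n smoothstep v <= 1 /\ 1 - iter n smoothstep v <= r ^+ n.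
  elim: n => [|n [/andP[h1 h2] h3]] /=.
    by rewrite expr0 lexx v1; split => //; lra.
  set w := iter n smoothstep v in h1 h2 h3 *.
  have e : 1 - smoothstep w = (1 - w) * (1 - w * (2 * w - 1)) by rewrite /smoothstep; ring.
  have w01 : 0 <= w <= 1 by rewrite h2 andbT; lra.
  split.
    have /andP[_ ->] := smoothstep_itv w01; rewrite andbT (le_trans h1)// -subr_ge0.
    have -> : smoothstep w - w = w * (1 - w) * (2 * w - 1) by rewrite /smoothstep; ring.
    by rewrite mulr_ge0 ?mulr_ge0//; lra.
  rewrite e exprS mulrC; apply: ler_pM => //.
  - by nra.
  - by lra.
  - by rewrite /r; nra.
apply/cvgrPdist_lt => eps eps0.
have /cvgrPdist_lt/(_ _ eps0) : r ^+ n @[n --> \oo] --> (0 : R).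
  by apply: cvg_expr; case/andP: r01 => ? ?; rewrite ger0_norm.
apply: filterS => n; rewrite sub0r normrN ger0_norm ?exprn_ge0//; last by case/andP: r01.
apply: le_lt_trans.
by have [/andP[_ ?] ?] := key n; rewrite ger0_norm ?subr_ge0.
Qed.

Lemma smoothstep_sym v : smoothstep (1 - v) = 1 - smoothstep v.
Proof. by rewrite /smoothstep; ring. Qed.

Lemma iter_smoothstep_sym n v : iter n smoothstep (1 - v) = 1 - iter n smoothstep v.
Proof. by elim: n => //= n ->; exact: smoothstep_sym. Qed.

Lemma iter_smoothstep_lt v : 0 <= v < 2^-1 ->
  iter n smoothstep v @[n --> \oo] --> (0 : R).
Proof.
move=> /andP[v0 v2].
have h : 2^-1 < 1 - v <= 1 by apply/andP; split; lra.
have -> : (fun n => iter n smoothstep v) = (fun n => 1 - iter n smoothstep (1 - v)).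
  by apply/funext => n; rewrite iter_smoothstep_sym; ring.
have e : 0 = 1 - 1 :> R by rewrite subrr.
rewrite [X in _ --> X]e; apply: cvgB; first exact: cvg_cst.
exact: iter_smoothstep_gt.
Qed.

Lemma iter_smoothstep_half n : iter n smoothstep 2^-1 = 2^-1.
Proof. by elim: n => //= n ->; rewrite /smoothstep; field. Qed.

(** The polynomial [2 x^2 - x] sends the limits 0, 1/2, 1 of the iterates to
    0, 0, 1, so that the midpoint does not contribute. *)
Lemma step_cvg v : 0 <= v <= 1 ->
  2 * (iter n smoothstep v * iter n smoothstep v) - iter n smoothstep v
    @[n --> \oo] --> ((2^-1 < v)%R%:R : R).
Proof.
move=> /andP[v0 v1].
have gen : forall l : R, iter n smoothstep v @[n --> \oo] --> l ->
    2 * (iter n smoothstep v * iter n smoothstep v) - iter n smoothstep v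
    @[n --> \oo] --> 2 * (l * l) - l.
  move=> l c; apply: cvgB => //; apply: cvgM; first exact: cvg_cst.
  exact: cvgM.
case: (ltgtP 2^-1 v) => h.
- have := gen _ (iter_smoothstep_gt (v := v) _).
  rewrite h v1 => /(_ isT); suff -> : 2 * (1 * 1) - 1 = 1%:R :> R by [].
  by ring.
- have := gen _ (iter_smoothstep_lt (v := v) _).
  rewrite h v0 => /(_ isT); suff -> : 2 * (0 * 0) - 0 = 0%:R :> R by [].
  by ring.
- have := gen (2^-1); suff -> : 2 * (2^-1 * 2^-1) - 2^-1 = 0%:R :> R.
    apply; rewrite -h; under eq_fun do rewrite iter_smoothstep_half.
    exact: cvg_cst.
  by field.
Qed.

End smoothstep.

Section density.
Context {R : realType} (nu : {measure set (measurableTypeR R) -> \bar R}).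
Hypothesis nu1 : nu [set: R] = 1%E.
Variable (D : set R).
Implicit Types (f g : R -> R[i]) (h : R -> R).
Hypothesis exp_inspan : forall t, inspan nu D (fourier_exp t).
Local Notation cmeas := (cmeasurable (T := measurableTypeR R)).
Local Notation multiplier := (multiplier nu D).
Local Notation inspan := (inspan nu D).

Lemma multiplierB h k : multiplier h -> multiplier k ->
  multiplier (fun x => h x - k x).
Proof.
move=> Hh Hk.
have := multiplierD Hh (multiplierM (multiplier_cst exp_inspan (-1)) Hk).
by congr multiplier; apply/funext => x; rewrite mulN1r.
Qed.

Lemma multiplier_smoothstep n h : multiplier h ->
  multiplier (fun x => iter n smoothstep (h x)).
Proof.
move=> Hh; elim: n => //= n IH.
apply: multiplierM; first exact: multiplierM.
apply: multiplierB; first exact: multiplier_cst.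
by apply: multiplierM => //; exact: multiplier_cst.
Qed.

Lemma multiplier_threshold h : multiplier h -> (forall x, 0 <= h x <= 1) ->
  multiplier (fun x => (2^-1 < h x)%R%:R).
Proof.
move=> Hh h01.
apply: (multiplier_lim nu1 (M := 1) (u := fun n x =>
   2 * (iter n smoothstep (h x) * iter n smoothstep (h x)) - iter n smoothstep (h x))).
- move=> n; apply: multiplierB; last exact: multiplier_smoothstep.
  apply: multiplierM; first exact: multiplier_cst.
  by apply: multiplierM; exact: multiplier_smoothstep.
- move=> n x; have /andP[] := iter_smoothstep_itv n (h01 x).
  set s := iter _ _ _ => s0 s1; rewrite ler_norml; apply/andP; split; nra.
- by move=> x; exact: step_cvg.
Qed.

(** Euler's formula: multiplying by the sine translates frequencies by [s] and
    [-s]. *)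
Lemma multiplier_sin (s y : R) :
  multiplier (fun x => sin (2 * pi * s * (x - y))).
Proof.
split.
- under eq_fun do rewrite mulrBr sinB.
  by apply: measurable_funB; apply: measurable_funM; try exact: measurable_cst;
    [exact: measurable_sin_lin|exact: measurable_cos_lin].
- by exists 1 => x; exact: sin_max.
move=> t.
have -> : (fun x => (sin (2 * pi * s * (x - y)))%:C * fourier_exp t x) =
  (fun x => ((0 -i* 2^-1) * fourier_exp s (- y)) * fourier_exp (t + s) x +
            ((0 +i* 2^-1) * fourier_exp s y) * fourier_exp (t - s) x).
  apply/funext => x.
  rewrite !fourier_expD ![fourier_exp t x * _]mulrC !mulrA -mulrDl; congr (_ * _).
  rewrite /fourier_exp !(mulrN, mulNr) !(cosN, sinN) mulrBr sinB /=.
  by apply/eqP; rewrite eq_complex /=; apply/andP; split; apply/eqP; field.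
by apply: inspanD; exact: inspanZ.
Qed.

(** For large [n], [sin (2 pi (x - y) / (n+1))] has the sign of [x - y]. *)
Lemma multiplier_ray (y : R) : multiplier (\1_(`]y, +oo[%classic)).
Proof.
apply: (multiplier_lim nu1 (M := 1) (u := fun n x =>
  (2^-1 < 2^-1 + sin (2 * pi * n.+1%:R^-1 * (x - y)) * 2^-1)%R%:R)).
- move=> n; apply: multiplier_threshold.
    apply: multiplierD; first exact: multiplier_cst.
    by apply: multiplierM; [exact: multiplier_sin|exact: multiplier_cst].
  move=> x; have := sin_le1 (2 * pi * n.+1%:R^-1 * (x - y)).
  have := sin_geN1 (2 * pi * n.+1%:R^-1 * (x - y)).
  by set s := sin _ => ? ?; apply/andP; split; lra.
- by move=> n x; rewrite normr_nat lern1 leq_b1.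
move=> x; rewrite indicE.
apply: cvg_near_cst; near=> n.
have pi0 := pi_gt0 R.
have nx : `|x - y| * 2 < n.+1%:R.
  apply: lt_le_trans (_ : n%:R <= _); last by rewrite ler_nat.
  near: n; exact: nbhs_infty_gtr.
rewrite mem_setE in_itv /= andbT ltrDl.
set a := 2 * pi * _ * _.
have aE : a = pi * ((x - y) * 2 / n.+1%:R) by rewrite /a; ring.
have nn : 0 < n.+1%:R :> R by [].
congr (_%:R); congr nat_of_bool.
have [xy|xy] := ltP y x.
  apply: mulr_gt0 => //; apply: sin_gt0_pi; rewrite aE.
  have h0 : 0 < (x - y) * 2 / n.+1%:R by rewrite divr_gt0 ?mulr_gt0 ?subr_gt0.
  have h1 : (x - y) * 2 / n.+1%:R < 1.
    by rewrite ltr_pdivrMr// mul1r (le_lt_trans _ nx)// ler_wpM2r// ler_norm.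
  by rewrite mulr_gt0//= -[ltRHS]mulr1 ltr_pM2l.
apply/negbTE; rewrite -leNgt.
suff : 0 <= sin (- a) by rewrite sinN; lra.
apply: sin_ge0_pi; rewrite aE -mulrN -!mulNr opprB.
have h0 : 0 <= (y - x) * 2 / n.+1%:R by rewrite divr_ge0 ?mulr_ge0 ?subr_ge0.
have h1 : (y - x) * 2 / n.+1%:R <= 1.
  rewrite ler_pdivrMr// mul1r ltW// (le_lt_trans _ nx)// ler_wpM2r//.
  by rewrite distrC ler_norm.
by rewrite mulr_ge0 ?(ltW pi0)//= -[leRHS]mulr1 ler_pM2l.
Unshelve. all: by end_near. Qed.

(** The sets whose indicator is a multiplier form a sigma-algebra: unions are
    handled through [1 - prod_i (1 - 1_(F i))]. *)
Lemma multiplier_indic (A : set (measurableTypeR R)) :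
  measurable A -> multiplier (\1_A).
Proof.
have -> : @measurable _ (measurableTypeR R) =
   <<s [set A : set R | exists x, A = `]x, +oo[%classic] >>.
  exact: RGenOInfty.measurableE.
move: A; apply: smallest_sub; last by move=> _ [y ->]; exact: multiplier_ray.
split => /=.
- have := multiplier_cst exp_inspan 0.
  by congr multiplier; apply/funext => x; rewrite indicE in_set0.
- move=> A HA; have := multiplierB (multiplier_cst exp_inspan 1) HA.
  congr multiplier; apply/funext => x; rewrite setTD !indicE in_setC.
  by case: (_ \in _); rewrite ?subrr ?subr0.
move=> F HF.
apply: (multiplier_lim nu1 (M := 1) (u := fun n x =>
   1 - \prod_(i < n) (1 - \1_(F i) x))).
- move=> n; apply: multiplierB; first exact: multiplier_cst.
  elim: n => [|n IH].
    by under eq_fun do rewrite big_ord0; exact: multiplier_cst.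
  under eq_fun do rewrite big_ord_recr /=.
  apply: multiplierM => //; apply: multiplierB => //; exact: multiplier_cst.
- move=> n x.
  suff /andP[? ?] : 0 <= \prod_(i < n) (1 - \1_(F i) x : R) <= 1.
    by rewrite ler_norml; apply/andP; split; lra.
  have h (i : 'I_n) : 0 <= (1 - \1_(F i) x : R) <= 1.
    by rewrite indicE; case: (_ \in _); rewrite ?subrr ?subr0 ?lexx ?ler01.
  rewrite prodr_ge0 /=; last by move=> i _; case/andP: (h i).
  by apply: prodr_ile1 => i _; exact: h.
move=> x; apply: cvg_near_cst; rewrite indicE.
have [[k _ Fkx]|nF] := pselect ((\bigcup_k F k) x).
  near=> n.
  have kn : (k < n)%N by near: n; exact: nbhs_infty_gt.
  rewrite (bigD1 (Ordinal kn))//= indicE mem_set// subrr mul0r subr0.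
  by rewrite mem_set//; exists k.
near=> n; rewrite memNset// big1 ?subrr// => i _.
by rewrite indicE memNset ?subr0// => Fi; apply: nF; exists i.
Unshelve. all: by end_near. Qed.

End density.

(** * Totality of exponentials and Bessel's identity *)

Section square_integrable_density.
Context {R : realType} (nu : {measure set (measurableTypeR R) -> \bar R}).
Hypothesis nu1 : nu [set: R] = 1%E.
Variable (D : set R).
Implicit Types (f g : R -> R[i]) (h : R -> R).
Hypothesis exp_inspan : forall t, inspan nu D (fourier_exp t).
Local Notation cmeas := (cmeasurable (T := measurableTypeR R)).
Local Notation inspan := (inspan nu D).

Lemma fourier_exp0 (x : R) : fourier_exp 0 x = 1.
Proof. by rewrite /fourier_exp mulr0 mul0r cos0 sin0. Qed.

Lemma inspan_indic (A : set (measurableTypeR R)) : measurable A ->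
  inspan (fun x => (\1_A x)%:C).
Proof.
move=> mA; have [_ _ /(_ 0)] := multiplier_indic nu1 exp_inspan mA.
by congr inspan; apply/funext => x; rewrite fourier_exp0 mulr1.
Qed.

Lemma inspan_nnsfun (h : {nnsfun (measurableTypeR R) >-> R}) :
  inspan (fun x => (h x)%:C).
Proof.
have -> : (fun x => (h x)%:C) = (fun x => \sum_(y <- finmap.enum_fset (fset_set (range h)))
    y%:C * (\1_(h @^-1` [set y]) x)%:C).
  apply/funext => x; rewrite fimfunE fsbig_finite//= rmorph_sum/=.
  by apply: eq_bigr => y _; rewrite rmorphM.
apply: inspan_sum => y; apply: inspanZ; apply: inspan_indic.
by rewrite -[X in measurable X]setTI; exact: measurable_funP.
Qed.

Lemma inspan_nonneg h : measurable_fun [set: measurableTypeR R] h ->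
  (forall x, 0 <= h x) -> (\int[nu]_x (h x ^+ 2)%:E < +oo)%E ->
  inspan (fun x => (h x)%:C).
Proof.
move=> mh h0 ih.
have meh : measurable_fun [set: measurableTypeR R] (EFin \o h).
  exact/measurable_EFinP.
pose u := nnsfun_approx measurableT meh.
have uh n x : u n x <= h x.
  by rewrite -lee_fin /u nnsfun_approxE; apply: le_approx => // y _; rewrite lee_fin.
have uc x : u n x @[n --> \oo] --> h x.
  have := @cvg_nnsfun_approx _ _ _ _ measurableT _ meh
    (fun y _ => h0 y : (0 <= (h y)%:E)%E) x I.
  exact: fine_cvg.
apply: inspan_lim; first exact: cmeasurable_real.
move=> eps eps0.
have [|||||n hn] := @sqL2_cvg0 _ nu (fun n x => (h x - u n x)%:C)
   (fun x => h x ^+ 2) _ _ _ _ eps.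
- move=> n; apply: cmeasurable_real; apply: measurable_funB => //.
- apply/integrableP; split; first by apply/measurable_EFinP; exact: measurable_funX.
  by under eq_integral do rewrite /= ger0_norm ?sqr_ge0//.
- move=> n x; rewrite sqr_normcR lerXn2r ?nnegrE ?subr_ge0//.
  by rewrite gerDl oppr_le0 fun_ge0.
- move=> x; under eq_fun do rewrite sqr_normcR expr2.
  have c : h x - u n x @[n --> \oo] --> h x - h x.
    by apply: cvgB; [exact: cvg_cst|exact: uc].
  rewrite subrr in c.
  by rewrite -[X in nbhs X](mulr0 0) => A; exact: (cvgM c c).
- by [].
exists (fun x => (u n x)%:C); split; first exact: inspan_nnsfun.
by move: hn; congr (sqL2 _ _ < _)%E; apply/funext => x; rewrite rmorphB.
Qed.

Lemma inspan_real h : measurable_fun [set: measurableTypeR R] h ->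
  (\int[nu]_x (h x ^+ 2)%:E < +oo)%E ->
  inspan (fun x => (h x)%:C).
Proof.
move=> mh ih.
have bound (k : R -> R) : measurable_fun [set: measurableTypeR R] k ->
    (forall x, 0 <= k x) -> (forall x, k x <= `|h x|) -> inspan (fun x => (k x)%:C).
  move=> mk k0 kh; apply: inspan_nonneg => //.
  apply: le_lt_trans ih; apply: ge0_le_integral => //.
  - by move=> x _; rewrite lee_fin sqr_ge0.
  - by apply/measurable_EFinP; exact: measurable_funX.
  - by apply/measurable_EFinP; exact: measurable_funX.
  - move=> x _; rewrite lee_fin -[leRHS]real_normK ?num_real// lerXn2r ?nnegrE//.
have -> : (fun x => (h x)%:C) = (fun x => ((`|h x| + h x) / 2)%:C +
    (- 1) * ((`|h x| - h x) / 2)%:C).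
  apply/funext => x; by rewrite mulN1r -rmorphB; congr (_%:C); field.
have mn : measurable_fun [set: measurableTypeR R] (fun x => `|h x|).
  exact: measurableT_comp.
apply: inspanD; last apply: inspanZ; apply: bound.
- by apply: measurable_funM; [exact: measurable_funD|exact: measurable_cst].
- by move=> x; have := ler_norm (- h x); rewrite normrN; lra.
- by move=> x; have := ler_norm (h x); lra.
- by apply: measurable_funM; [exact: measurable_funB|exact: measurable_cst].
- by move=> x; have := ler_norm (h x); lra.
- by move=> x; have := ler_norm (- h x); rewrite normrN; lra.
Qed.

(** Indicators generate: simple functions, then nonnegative square-integrable
    functions by dominated convergence of their approximations from below, then
    signed and complex ones. *)
Lemma inspan_square_integrable f : square_integrable nu f -> inspan f.
Proof.
move=> [mr mi intf].
have bound (k : R -> R) : measurable_fun [set: measurableTypeR R] k ->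
    (forall x, k x ^+ 2 <= Normc.normc (f x) ^+ 2) -> inspan (fun x => (k x)%:C).
  move=> mk kf; apply: inspan_real => //.
  apply: le_lt_trans intf; apply: ge0_le_integral => //.
  - by move=> x _; rewrite lee_fin sqr_ge0.
  - by apply/measurable_EFinP; exact: measurable_funX.
  - by apply/measurable_EFinP; exact: measurable_sqr_normc.
  - by move=> x _; rewrite lee_fin.
have -> : f = (fun x => (complex.Re (f x))%:C + (0 +i* 1) * (complex.Im (f x))%:C).
  apply/funext => x; case: (f x) => a b /=.
  by apply/eqP; rewrite eq_complex /=; apply/andP; split; apply/eqP; ring.
apply: inspanD; last apply: inspanZ; apply: bound => // x.
  by rewrite sqr_normcE lerDl sqr_ge0.
by rewrite sqr_normcE lerDr sqr_ge0.
Qed.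

Lemma trigsum_undup (l : seq (R * R[i])) (x : R) :
  trigsum l x = \sum_(t <- undup (map fst l))
    (\sum_(p <- l | p.1 == t) p.2) * fourier_exp t x.
Proof.
rewrite /trigsum; under [RHS]eq_bigr do rewrite mulr_suml.
rewrite (exchange_big_dep predT)//=; apply: eq_big_seq => p pl.
rewrite -big_filter (eq_filter (a2 := pred1 p.1)); last by move=> t; rewrite /= eq_sym.
by rewrite filter_pred1_uniq ?undup_uniq ?mem_undup ?map_f// big_seq1.
Qed.

Lemma inspan_complete f : inspan f -> forall eps : R, 0 < eps ->
  exists (s : seq R) (c : R -> R[i]), (forall t, t \in s -> D t) /\
    (\int[nu]_x (Normc.normc (f x - \sum_(t <- s) c t * fourier_exp t x) ^+ 2)%:E
      < eps%:E)%E.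
Proof.
move=> [_ Hf] eps /Hf [l [lD hl]].
exists (undup (map fst l)), (fun t => \sum_(p <- l | p.1 == t) p.2); split.
  by move=> t; rewrite mem_undup => /mapP[p /lD ? ->].
move: hl; rewrite /sqL2; congr (_ < _)%E; apply: eq_integral => x _.
by rewrite trigsum_undup.
Qed.

End square_integrable_density.

Section parseval.
Context {R : realType} (nu : {measure set (measurableTypeR R) -> \bar R}).
Hypothesis nu1 : nu [set: R] = 1%E.
Implicit Types (f g : R -> R[i]) (t u : R).
Local Notation cmeas := (cmeasurable (T := measurableTypeR R)).

Definition cintegrable f : Prop :=
  nu.-integrable [set: measurableTypeR R] (EFin \o (fun x => complex.Re (f x))) /\
  nu.-integrable [set: measurableTypeR R] (EFin \o (fun x => complex.Im (f x))).

Lemma cintegrable_bounded (M : R) f : cmeas f ->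
  (forall x, Normc.normc (f x) ^+ 2 <= M) -> cintegrable f.
Proof.
move=> [mr mi] fM.
have b (k : R -> R) : measurable_fun [set: measurableTypeR R] k ->
    (forall x, k x ^+ 2 <= M) ->
    nu.-integrable [set: measurableTypeR R] (EFin \o k).
  move=> mk kM; apply: measurable_bounded_integrable => //; first by rewrite nu1 ltry.
  exists (M + 1); split; first exact: num_real.
  move=> y My x _ /=; have := kM x; rewrite -[X in X <= _]real_normK ?num_real//.
  have := normr_ge0 (k x); move: (`|k x|) => z z0 zM; nra.
split; apply: b => // x; apply: le_trans (fM x); rewrite sqr_normcE.
  by rewrite lerDl sqr_ge0.
by rewrite lerDr sqr_ge0.
Qed.

Lemma cintegralD f g : cintegrable f -> cintegrable g ->
  cintegrable (fun x => f x + g x) /\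
  cintegral nu (fun x => f x + g x) = cintegral nu f + cintegral nu g.
Proof.
move=> [fr fi] [gr gi].
have ReD x : complex.Re (f x + g x) = complex.Re (f x) + complex.Re (g x).
  by case: (f x) (g x) => ? ? [].
have ImD x : complex.Im (f x + g x) = complex.Im (f x) + complex.Im (g x).
  by case: (f x) (g x) => ? ? [].
split.
  split; [rewrite (_ : _ \o _ = (EFin \o (fun x => complex.Re (f x))) \+
                                (EFin \o (fun x => complex.Re (g x))))%E|
    rewrite (_ : _ \o _ = (EFin \o (fun x => complex.Im (f x))) \+
                          (EFin \o (fun x => complex.Im (g x))))%E];
    try (by apply/funext => x /=; rewrite ?ReD ?ImD); exact: integrableD.
rewrite /cintegral; under eq_Rintegral do rewrite ReD.
rewrite RintegralD//; congr (_ +i* _).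
under eq_Rintegral do rewrite ImD.
by rewrite RintegralD.
Qed.

Lemma cintegral0 : cintegrable (fun _ => 0) /\ cintegral nu (fun _ => 0) = 0.
Proof.
split; first by apply: (@cintegrable_bounded 0) => [|x];
  [exact: cmeasurable_cst|rewrite Normc.normc0 expr0n].
by rewrite /cintegral /=/Rintegral integral0.
Qed.

Lemma cintegralZ (c : R[i]) f : cintegrable f ->
  cintegrable (fun x => c * f x) /\
  cintegral nu (fun x => c * f x) = c * cintegral nu f.
Proof.
move=> [fr fi]; case: c => a b.
have ReM x : complex.Re ((a +i* b) * f x) = a * complex.Re (f x) - b * complex.Im (f x).
  by case: (f x).
have ImM x : complex.Im ((a +i* b) * f x) = a * complex.Im (f x) + b * complex.Re (f x).
  by case: (f x).
have iZ (k : R) (h : R -> R) : nu.-integrable [set: measurableTypeR R] (EFin \o h) ->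
    nu.-integrable [set: measurableTypeR R] (EFin \o (fun x => k * h x)).
  move=> ih; rewrite (_ : _ \o _ = (fun x => k%:E * (EFin \o h) x)%E); last first.
    by apply/funext => x /=; rewrite EFinM.
  exact: integrableZl.
split.
  split.
    rewrite (_ : _ \o _ = (EFin \o (fun x => a * complex.Re (f x))%R) \-
      (EFin \o (fun x => b * complex.Im (f x))%R))%E.
      by apply: integrableB => //; exact: iZ.
    by apply/funext => x /=; rewrite ReM.
  rewrite (_ : _ \o _ = (EFin \o (fun x => a * complex.Im (f x))%R) \+
      (EFin \o (fun x => b * complex.Re (f x))%R))%E.
    by apply: integrableD => //; exact: iZ.
  by apply/funext => x /=; rewrite ImM.
rewrite /cintegral; under eq_Rintegral do rewrite ReM.
rewrite RintegralB//; try exact: iZ.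
rewrite !RintegralZl//.
under [X in _ +i* X]eq_Rintegral do rewrite ImM.
rewrite RintegralD//; try exact: iZ.
by rewrite !RintegralZl.
Qed.

Definition fourier_coef t : R[i] := cintegral nu (fourier_exp t).

Lemma cintegrable_fourier t : cintegrable (fourier_exp t).
Proof.
apply: (@cintegrable_bounded 1); first exact: cmeasurable_fourier.
by move=> x; rewrite sqr_normc_fourier.
Qed.

Lemma cintegral_sum (I : Type) (s : seq I) (a : I -> R[i]) (t : I -> R) :
  cintegrable (fun x => \sum_(i <- s) a i * fourier_exp (t i) x) /\
  cintegral nu (fun x => \sum_(i <- s) a i * fourier_exp (t i) x) =
    \sum_(i <- s) a i * fourier_coef (t i).
Proof.
elim: s => [|i s [i1 e1]].
  rewrite big_nil; under eq_fun do rewrite big_nil; exact: cintegral0.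
rewrite big_cons; under eq_fun do rewrite big_cons.
have [i2 e2] := cintegralZ (a i) (cintegrable_fourier (t i)).
by have [i3 e3] := cintegralD i2 i1; split => //; rewrite e3 e2 e1.
Qed.

Lemma fourier_exp_conj t x : (fourier_exp t x)^* = fourier_exp (- t) x :> R[i].
Proof. by rewrite /fourier_exp mulrN mulNr cosN sinN. Qed.

Lemma fourier_coefN t : fourier_coef (- t) = (fourier_coef t)^*.
Proof.
rewrite /fourier_coef /cintegral /fourier_exp /=.
under eq_Rintegral do rewrite mulrN mulNr cosN.
congr (_ +i* _).
under eq_Rintegral do rewrite mulrN mulNr sinN -mulN1r.
rewrite RintegralZl ?mulN1r//; by have [] := cintegrable_fourier t.
Qed.

Lemma fourier_coef0 : fourier_coef 0 = 1.
Proof.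
rewrite /fourier_coef /cintegral; under eq_Rintegral do rewrite fourier_exp0 /=.
under [X in _ +i* X]eq_Rintegral do rewrite fourier_exp0 /=.
by rewrite !Rintegral_cst//= nu1 /= mul0r mul1r.
Qed.

Lemma L2_inner_fourier t u :
  L2_inner nu (fourier_exp t) (fourier_exp u) = fourier_coef (t - u).
Proof.
rewrite /L2_inner; congr cintegral; apply/funext => x.
by rewrite fourier_exp_conj -fourier_expD.
Qed.

Lemma sqL2_trigsum (l : seq (R * R[i])) : sqL2 nu (trigsum l) =
  (complex.Re (\sum_(p <- l) \sum_(q <- l)
     p.2 * (q.2)^* * fourier_coef (p.1 - q.1)))%:E.
Proof.
have e x : Normc.normc (trigsum l x) ^+ 2 = complex.Re
   (\sum_(pq <- [seq (p, q) | p <- l, q <- l])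
      (pq.1.2 * (pq.2.2)^*) * fourier_exp (pq.1.1 - pq.2.1) x).
  rewrite big_allpairs_dep /=.
  have -> z : Normc.normc z ^+ 2 = complex.Re (z * z^*) :> R.
    by rewrite sqr_normcE; case: z => a b /=; ring.
  congr complex.Re; rewrite /trigsum rmorph_sum /= mulr_suml; apply: eq_bigr => p _.
  rewrite mulr_sumr; apply: eq_bigr => q _.
  rewrite [X in _ * X = _](_ : _ = (q.2)^* * fourier_exp (- q.1) x).
    by rewrite fourier_expD mulrACA.
  by rewrite -fourier_exp_conj; exact: rmorphM.
rewrite /sqL2; under eq_integral do rewrite e.
have [[iR _] eI] := cintegral_sum [seq (p, q) | p <- l, q <- l]
   (fun pq => pq.1.2 * (pq.2.2)^*) (fun pq => pq.1.1 - pq.2.1).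
rewrite big_allpairs_dep /= in eI; rewrite -eI /= /Rintegral fineK//.
exact: integrable_fin_num.
Qed.

(** Bessel's identity for the orthogonal projection of [e_t] on the span of the
    [e_l]; the Fourier coefficients of the measure are the inner products. *)
Lemma sqL2_bessel t (s : seq R) : uniq s ->
  (forall x y, x \in s -> y \in s -> x != y -> fourier_coef (x - y) = 0) ->
  sqL2 nu (fun x => fourier_exp t x -
     trigsum [seq (l, fourier_coef (t - l)) | l <- s] x)%R =
  (1 - \sum_(l <- s) Normc.normc (fourier_coef (t - l)) ^+ 2)%:E.
Proof.
move=> us orth.
pose c l := fourier_coef (t - l).
have -> : (fun x => fourier_exp t x - trigsum [seq (l, c l) | l <- s] x) =
    trigsum ((t, 1) :: [seq (l, - c l) | l <- s]).
  apply/funext => x; rewrite /trigsum big_cons !big_map mul1r; congr (_ + _).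
  by rewrite -sumrN; apply: eq_bigr => l _; rewrite mulNr.
pose nn l : R[i] := (Normc.normc (c l) ^+ 2)%:C.
have nnE l : c l * (c l)^* = nn l.
  rewrite /nn sqr_normcE; case: (c l) => a b.
  by apply/eqP; rewrite eq_complex /=; apply/andP; split; apply/eqP; ring.
have -> : 1 - \sum_(l <- s) Normc.normc (fourier_coef (t - l)) ^+ 2 =
    complex.Re (1 - \sum_(l <- s) nn l).
  have ReB z w : complex.Re (z - w) = complex.Re z - complex.Re w :> R.
    by case: z w => ? ? [].
  rewrite ReB; congr (1 - _); elim: (s) => [|l r IH]; first by rewrite !big_nil.
  by rewrite !big_cons IH /nn; case: (\sum_(_ <- _) _).
rewrite sqL2_trigsum; congr (complex.Re _)%:E.
rewrite !big_cons !big_map subrr fourier_coef0 !mulr1 rmorph1 mulr1.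
have -> : \sum_(l <- s) 1 * (- c l)^* * fourier_coef (t - l) = - \sum_(l <- s) nn l.
  rewrite -sumrN; apply: eq_bigr => l _; rewrite mul1r rmorphN mulNr mulrC.
  by rewrite nnE.
have e3 l : - c l * 1^* * fourier_coef (l - t) = - nn l.
  by rewrite rmorph1 mulr1 -opprB fourier_coefN mulNr nnE.
under eq_bigr => l _ do rewrite big_cons big_map [X in X + _](e3 l).
rewrite big_split /= sumrN.
have -> : \sum_(l <- s) \sum_(m <- s) - c l * (- c m)^* * fourier_coef (l - m) =
          \sum_(l <- s) nn l.
  apply: eq_big_seq => l ls; rewrite (bigD1_seq l)//= subrr fourier_coef0 mulr1.
  rewrite rmorphN mulrNN nnE big1_seq ?addr0// => m /andP[ml ms].
  by rewrite orth ?mulr0// eq_sym.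
by rewrite addNr addr0.
Qed.

End parseval.

(** * A criterion for spectrality *)

Section spectral_criterion.
Context {R : realType} (nu : {measure set (measurableTypeR R) -> \bar R}).
Hypothesis nu1 : nu [set: R] = 1%E.
Variable S : nat -> bool.
Hypothesis nuS : forall t,
  cosprod S n t @[n --> \oo] --> Normc.normc (fourier_coef nu t) ^+ 2.

Let Lambda : set R := [set x | exists n, x \in spectrum_upto S n].

Lemma spectrum_fourier_coef0 n x y : x \in spectrum_upto S n ->
  y \in spectrum_upto S n -> x != y ->
  fourier_coef nu (x - y) = 0.
Proof.
move=> xs ys xy; apply: Normc.eq0_normc.
suff /eqP : Normc.normc (fourier_coef nu (x - y)) ^+ 2 = 0 by rewrite expf_eq0 => /eqP.
have c0 : cosprod S m (x - y) @[m --> \oo] --> (0 : R).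
  apply: cvg_near_cst; near=> m; apply/eqP.
  rewrite eq_le cosprod_ge0 andbT -(spectrum_orth xs ys xy).
  by apply: cosprod_anti; near: m; exact: nbhs_infty_ge.
by rewrite -(cvg_lim _ (@nuS (x - y)))// (cvg_lim _ c0).
Unshelve. all: by end_near. Qed.

(** Orthogonality is the vanishing of the product at differences of frequencies.
    By [spectrum_total] and Bessel's identity all exponentials lie in the closed
    span, and exponentials are total. *)
Lemma cosprod_spectral : spectral_measure nu.
Proof.
split => //; exists Lambda.
have common x y : Lambda x -> Lambda y ->
    exists n, x \in spectrum_upto S n /\ y \in spectrum_upto S n.
  move=> [n xn] [m ym]; exists (maxn n m); split.
    by have [r ->] := @spectrum_prefix R S _ _ (leq_maxl n m); rewrite mem_cat xn.
  by have [r ->] := @spectrum_prefix R S _ _ (leq_maxr n m); rewrite mem_cat ym.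
have exp_inspan t : inspan nu Lambda (fourier_exp t).
  split; first exact: cmeasurable_fourier.
  move=> eps eps0; have [n hn] := spectrum_total t nuS eps0.
  exists [seq (l, fourier_coef nu (t - l)) | l <- spectrum_upto S n]; split.
    by move=> _ /mapP[l ls ->]; exists n.
  rewrite sqL2_bessel//; last 2 first.
  - exact: spectrum_uniq.
  - exact: spectrum_fourier_coef0.
  by rewrite lte_fin; move: hn; lra.
split.
- move=> t _; have [mr mi] := cmeasurable_fourier t; split => //.
  under eq_integral do rewrite sqr_normc_fourier.
  by rewrite integral_cst// nu1 mule1 ltry.
- move=> x y Lx Ly; have [n [xn yn]] := common _ _ Lx Ly; rewrite L2_inner_fourier.
  have [->|xy] := eqVneq x y; first by rewrite subrr fourier_coef0.
  exact: spectrum_fourier_coef0 xn yn xy.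
- move=> f /(inspan_square_integrable nu1 exp_inspan).
  exact: inspan_complete.
Qed.

End spectral_criterion.

(** * Digits of a uniform point *)

Section unit_measure.
Context {R : realType}.

Lemma measurable_itv01 : measurable (`[0, 1[%classic : set (measurableTypeR R)).
Proof. exact: measurable_itv. Qed.

(** The probability space on which both the fair bits and the Bernoulli sequences
    are realised. *)
Definition uniform01 : set (measurableTypeR R) -> \bar R :=
  mrestr (@lebesgue_measure R) measurable_itv01.

HB.instance Definition _ := Measure.on uniform01.

Lemma uniform01_setT : uniform01 [set: measurableTypeR R] = 1%E.
Proof.
by rewrite /uniform01 /mrestr setTI lebesgue_measure_itv /= lte_fin ltr01 oppr0 adde0.
Qed.

HB.instance Definition _ := Measure_isProbability.Build _ _ _ uniform01 uniform01_setT.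

End unit_measure.

Section expansion.
Context {R : realType} (p : R).
Hypothesis p01 : 0 < p < 1.

(** The piecewise affine map of [[0, 1)] that stretches [[0, p)] and [[p, 1)] onto
    [[0, 1)]; the digit of a point tells in which piece it lies, so that the digits
    of a uniform point are independent with probability [p] of being true. *)
Definition expansion_map (y : R) : R := if y < p then y / p else (y - p) / (1 - p).
Definition digit (i : nat) (y : R) : bool := iter i expansion_map y < p.

Definition weight (b : bool) : R := if b then p else 1 - p.

Lemma weight_gt0 b : 0 < weight b.
Proof. by have /andP[? ?] := p01; case: b; rewrite /weight; lra. Qed.

Lemma measurable_expansion_map :
  measurable_fun [set: measurableTypeR R]
    (expansion_map : measurableTypeR R -> measurableTypeR R).
Proof.
apply: measurable_fun_ifT.
- by apply: measurable_fun_ltr => //; exact: measurable_cst.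
- by apply: measurable_funM => //; exact: measurable_cst.
- apply: measurable_funM; last exact: measurable_cst.
  by apply: measurable_funB => //; exact: measurable_cst.
Qed.

Lemma measurable_digit i :
  measurable_fun [set: measurableTypeR R] (digit i : measurableTypeR R -> bool).
Proof.
apply: measurable_fun_ltr; last exact: measurable_cst.
elim: i => [|i IH]; first exact: measurable_id.
exact: (measurableT_comp measurable_expansion_map IH).
Qed.

Fixpoint cyl_lo (w : seq bool) : R :=
  if w is b :: w' then (if b then p * cyl_lo w' else p + (1 - p) * cyl_lo w') else 0.

Definition cyl_wt (w : seq bool) : R := \prod_(b <- w) weight b.

(** The points with prescribed first digits form an interval whose length is the
    product of the weights: the map is affine on the two pieces, so a cylinder
    shrinks by the weight of each digit put in front. *)
Lemma cylE (w : seq bool) (y : R) :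
  (0 <= y < 1 /\ forall i, (i < size w)%N -> digit i y = nth false w i) <->
  cyl_lo w <= y < cyl_lo w + cyl_wt w.
Proof.
have [p0 p1] : 0 < p /\ 0 < 1 - p by have /andP[? ?] := p01; split; lra.
elim: w y => [|b w IH] y.
  by rewrite /cyl_wt big_nil add0r; split => [[]|].
have bw : (0 <= expansion_map y < 1 /\
     forall i, (i < size w)%N -> digit i (expansion_map y) = nth false w i)
   <-> cyl_lo w <= expansion_map y < cyl_lo w + cyl_wt w by exact: IH.
have : (0 <= y < 1 /\ forall i, (i < size (b :: w))%N -> digit i y = nth false (b :: w) i)
   <-> (y < p) = b /\ (0 <= expansion_map y < 1 /\
         forall i, (i < size w)%N -> digit i (expansion_map y) = nth false w i).
  split=> [[y01 H]|[yb [s01 H]]].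
    split; first exact: (H 0%N).
    split; last by move=> i iw; have := H i.+1 iw; rewrite /digit iterSr.
    rewrite /expansion_map; case: ifPn => yp.
      by rewrite divr_ge0 ?ltr_pdivrMr//=; lra.
    rewrite -leNgt in yp.
    by rewrite divr_ge0 ?ltr_pdivrMr//=; lra.
  split; last by case=> [|i] iw //=; rewrite -(H i)// /digit iterSr.
  move: s01; rewrite /expansion_map; case: ifPn => yp.
    by rewrite ler_pdivlMr// ltr_pdivrMr// => ?; lra.
  by rewrite -leNgt in yp; rewrite ler_pdivlMr// ltr_pdivrMr// => ?; lra.
move=> ->; rewrite bw /cyl_wt big_cons -/(cyl_wt w).
have lo0 v : 0 <= cyl_lo v /\ cyl_lo v + cyl_wt v <= 1.
  elim: v => [|c v [h1 h2]]; first by rewrite /cyl_wt big_nil add0r.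
  have w0 : 0 <= cyl_wt v by apply: prodr_ge0 => ? _; exact/ltW/weight_gt0.
  by rewrite /cyl_wt big_cons -/(cyl_wt v) /weight /=; case: c; split; nra.
have [h1 h2] := lo0 w.
rewrite /expansion_map /weight /=; case: b; split.
- by move=> [yp]; rewrite yp ler_pdivlMr// -ltr_pdivlMr ?invr_gt0// invrK => ?; lra.
- move=> /andP[a1 a2]; have yp : y < p by nra.
  by rewrite yp ler_pdivlMr// -ltr_pdivlMr ?invr_gt0// invrK; split=> //; lra.
- by move=> [yp]; rewrite yp ler_pdivlMr// -ltr_pdivlMr ?invr_gt0// invrK => ?; lra.
- move=> /andP[a1 a2]; have yp : (y < p) = false by apply/negbTE; rewrite -leNgt; nra.
  by rewrite yp ler_pdivlMr// -ltr_pdivlMr ?invr_gt0// invrK; split=> //; lra.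
Qed.

Definition digits n (y : R) : {ffun 'I_n -> bool} := [ffun i : 'I_n => digit i y].

Definition word_weight n (f : {ffun 'I_n -> bool}) : R := \prod_(i < n) weight (f i).

Lemma measurable_cyl n (f : {ffun 'I_n -> bool}) :
  measurable ([set y | digits n y = f] : set (measurableTypeR R)).
Proof.
have -> : [set y | digits n y = f] =
    \bigcap_(i in [set: 'I_n]) (digit i @^-1` [set f i]).
  apply/seteqP; split=> y /=.
    by move=> <- i _ /=; rewrite ffunE.
  by move=> H; apply/ffunP => i; rewrite ffunE; exact: H.
apply: fin_bigcap_measurable; first exact: finite_finset.
by move=> i _; rewrite -[X in measurable X]setTI; exact: measurable_digit.
Qed.

Lemma uniform01_cyl n (f : {ffun 'I_n -> bool}) :
  uniform01 [set y | digits n y = f] = (word_weight f)%:E.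
Proof.
pose w := [seq f i | i <- enum 'I_n].
have sw : size w = n by rewrite size_map size_enum_ord.
have ww : cyl_wt w = word_weight f.
  by rewrite /cyl_wt /w big_map big_enum.
have -> : uniform01 [set y | digits n y = f] =
    lebesgue_measure (`[cyl_lo w, (cyl_lo w + cyl_wt w)[%classic : set R).
  congr (lebesgue_measure _); apply/seteqP; split=> y /=.
    rewrite !in_itv /= => -[fy y01]; apply/cylE; split=> // i.
    rewrite sw => ilt; rewrite (nth_map (Ordinal ilt)) ?size_enum_ord//.
    by rewrite -fy ffunE nth_enum_ord.
  rewrite !in_itv /= => /cylE[y01 H]; split=> //; apply/ffunP => i.
  rewrite ffunE H ?sw// (nth_map i) ?size_enum_ord//; congr (f _).
  by apply: val_inj; rewrite /= nth_enum_ord.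
rewrite lebesgue_measure_itv /= lte_fin ltrDl.
have -> : 0 < cyl_wt w by apply: prodr_gt0 => ? _; exact: weight_gt0.
by rewrite -EFinB addrAC subrr add0r ww.
Qed.

Lemma digits_indic n (F : {ffun 'I_n -> bool} -> R) (y : R) :
  F (digits n y) = \sum_f F f * \1_[set y | digits n y = f] y.
Proof.
rewrite (bigD1 (digits n y))//= indicE mem_set//= mulr1 big1 ?addr0// => f ne.
by rewrite indicE memNset ?mulr0// => /= e; rewrite e eqxx in ne.
Qed.

Lemma measurable_digits n (F : {ffun 'I_n -> bool} -> R) :
  measurable_fun [set: measurableTypeR R] (fun y => F (digits n y)).
Proof.
under eq_fun do rewrite digits_indic.
apply: measurable_sum => f; apply: measurable_funM; first exact: measurable_cst.
by apply: measurable_indic; exact: measurable_cyl.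
Qed.

Lemma integrable_digits n (F : {ffun 'I_n -> bool} -> R) :
  uniform01.-integrable [set: measurableTypeR R] (EFin \o (fun y => F (digits n y))).
Proof.
apply: measurable_bounded_integrable => //.
- by rewrite [X in (X < _)%E]uniform01_setT ltry.
- exact: measurable_digits.
exists (\sum_f `|F f|); split; first exact: num_real.
move=> M hM y _ /=; apply: le_trans (ltW hM).
by rewrite (bigD1 (digits n y))//= lerDl sumr_ge0.
Qed.

(** Integration of a function of the first [n] digits is a finite sum over words;
    product functions of words then integrate to products. *)
Lemma integral_digits n (F : {ffun 'I_n -> bool} -> R) :
  \int[uniform01]_y F (digits n y) = \sum_f word_weight f * F f.
Proof.
under eq_Rintegral do rewrite digits_indic.
pose G f y := F f * \1_[set y | digits n y = f] y.
have iG f : uniform01.-integrable [set: measurableTypeR R] (EFin \o G f).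
  rewrite (_ : G f = (fun y => (fun g => F f * (g == f)%:R) (digits n y))); last first.
    apply/funext => y; rewrite /G indicE; congr (_ * _%:R); congr nat_of_bool.
    by apply/idP/eqP; rewrite inE.
  exact: (integrable_digits (fun g => F f * (g == f)%:R)).
have : forall r : seq {ffun 'I_n -> bool},
    \int[uniform01]_y (\sum_(f <- r) G f y) = \sum_(f <- r) word_weight f * F f /\
    uniform01.-integrable [set: measurableTypeR R] (EFin \o (fun y => \sum_(f <- r) G f y)).
  elim=> [|f r [e i]].
    rewrite big_nil; under eq_Rintegral do rewrite big_nil.
    split; first by rewrite Rintegral_cst// mul0r.
    by under eq_fun do rewrite big_nil; exact: integrable0.
  rewrite big_cons; under eq_Rintegral do rewrite big_cons.
  split.
    rewrite RintegralD// e; congr (_ + _).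
    rewrite /G RintegralZl//; last first.
      by apply: integrable_indic => //; exact: measurable_cyl.
    rewrite mulrC; congr (_ * _).
    rewrite /Rintegral integral_indic//; last exact: measurable_cyl.
    by rewrite setIT [X in fine X]uniform01_cyl.
  rewrite (_ : _ \o _ = (EFin \o G f) \+ (EFin \o (fun y => \sum_(j <- r) G j y)%R))%E.
    exact: integrableD.
  by apply/funext => y /=; rewrite big_cons.
by move=> /(_ (index_enum _)) [].
Qed.

End expansion.

(** * The law of a random binary sum *)

Section binary_value.
Context {R : realType}.
Implicit Types (b : nat -> bool) (n : nat).

(** Digits are indexed from 0, so the digit [b i] has weight [2^-(i+1)]. *)
Definition psum b n : R := \sum_(i < n) (b i)%:R / 2 ^+ i.+1.
Definition binval b : R := limn (psum b).

Lemma psumS b n : psum b n.+1 = psum b n + (b n)%:R / 2 ^+ n.+1.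
Proof. by rewrite /psum big_ord_recr. Qed.

Lemma psum_term_ge0 (c : bool) n : 0 <= c%:R / 2 ^+ n :> R.
Proof. by rewrite divr_ge0// exprn_ge0. Qed.

Lemma psum_nd b : nondecreasing_seq (psum b).
Proof. by apply/nondecreasing_seqP => n; rewrite psumS lerDl psum_term_ge0. Qed.

(** The digits of index at least [n] contribute at most a geometric series; the
    last term [2^-(n+k)] makes comparisons strict in [psum_ltd]. *)
Lemma psum_tail b n k : psum b (n + k) <= psum b n + 2 ^- n - 2 ^- (n + k).
Proof.
elim: k => [|k IH]; first by rewrite addn0 addrK.
rewrite addnS psumS; apply: le_trans (lerD IH (lexx _)) _.
have e : 2 ^- (n + k) = 2 * 2 ^- (n + k).+1 :> R.
  by rewrite exprS invfM mulrA divff// mul1r.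
have : (b (n + k)%N)%:R / 2 ^+ (n + k).+1 <= 2 ^- (n + k).+1 :> R.
  by rewrite ler_piMl ?invr_ge0 ?exprn_ge0// lern1 leq_b1.
by rewrite e; lra.
Qed.

Lemma psum_le b n k : psum b k <= psum b n + 2 ^- n.
Proof.
have p2 m : 0 <= 2 ^- m :> R by rewrite invr_ge0 exprn_ge0.
case: (leqP k n) => [kn|/ltnW nk].
  by apply: le_trans (psum_nd b kn) _; rewrite lerDl.
by rewrite -(subnKC nk); apply: le_trans (psum_tail _ _ _) _; rewrite gerDl oppr_le0.
Qed.

Lemma psum_cvg b : psum b n @[n --> \oo] --> binval b.
Proof.
suff : cvgn (psum b) by [].
apply: nondecreasing_is_cvgn; first exact: psum_nd.
by exists (psum b 0 + 2 ^- 0) => _ [n _ <-]; exact: psum_le.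
Qed.

Lemma binval_ge b n : psum b n <= binval b.
Proof. by apply: nondecreasing_cvgn_le; [exact: psum_nd|exact: psum_cvg]. Qed.

Lemma binval_le b n : binval b <= psum b n + 2 ^- n.
Proof.
apply: limr_le; first exact: psum_cvg.
by apply: nearW => k; exact: psum_le.
Qed.

End binary_value.

Section binary_law.
Context {R : realType}.
Implicit Types (S : nat -> bool).

Definition half : R := 2^-1.
Lemma half01 : 0 < half < 1. Proof. by rewrite /half; apply/andP; split; lra. Qed.

(** The fair bits of [y], kept at the positions in [S] only. *)
Definition thin S (y : R) : nat -> bool := fun i => S i && digit half i y.

Definition fpsum S n (f : {ffun 'I_n -> bool}) : R :=
  \sum_(i < n) (S i && f i)%:R / 2 ^+ i.+1.

Lemma psum_thinE S n y : psum (thin S y) n = fpsum S (digits half n y).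
Proof. by apply: eq_bigr => i _; rewrite ffunE. Qed.

Definition binmap S (y : measurableTypeR R) : measurableTypeR R := binval (thin S y).

Lemma measurable_binmap S :
  measurable_fun [set: measurableTypeR R] (binmap S).
Proof.
apply: (measurable_fun_cvg (h := fun n y => psum (thin S y) n)).
  move=> n; under eq_fun do rewrite psum_thinE; exact: measurable_digits.
by move=> y _; exact: psum_cvg.
Qed.

HB.instance Definition _ S := isMeasurableFun.Build _ _
  (measurableTypeR R) (measurableTypeR R) (binmap S) (measurable_binmap S).

Definition binlaw S : probability (measurableTypeR R) R :=
  distribution uniform01 (binmap S : {mfun measurableTypeR R >-> measurableTypeR R}).

Lemma binlaw_setT S : binlaw S [set: R] = 1%E.
Proof. exact: probability_setT. Qed.

Lemma sum_realC (I : Type) (r : seq I) (a : I -> R) (z : I -> R[i]) :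
  \sum_(i <- r) (a i)%:C * z i =
  (\sum_(i <- r) a i * complex.Re (z i)) +i* (\sum_(i <- r) a i * complex.Im (z i)).
Proof.
elim: r => [|i r IH]; first by rewrite !big_nil.
rewrite !big_cons IH; case: (z i) => u v.
by apply/eqP; rewrite eq_complex /=; apply/andP; split; apply/eqP; ring.
Qed.

Lemma fourier_exp_x0 (t : R) : fourier_exp t 0 = 1 :> R[i].
Proof. by rewrite /fourier_exp mulr0 cos0 sin0. Qed.

(** The exponential of a sum of independent bits is a product of independent
    factors, and the mean of [1] and [exp (2 i a)] has modulus [|cos a|]. *)
Lemma partial_fourier S n (t : R) :
  Normc.normc ((\int[uniform01]_y cos (2 * pi * t * psum (thin S y) n)) +i*
               (\int[uniform01]_y sin (2 * pi * t * psum (thin S y) n))) ^+ 2 =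
  cosprod S n t.
Proof.
under eq_Rintegral do rewrite psum_thinE.
rewrite (integral_digits half01 (fun f => cos (2 * pi * t * fpsum S f))).
under [X in _ +i* X]eq_Rintegral do rewrite psum_thinE.
rewrite (integral_digits half01 (fun f => sin (2 * pi * t * fpsum S f))).
rewrite -(sum_realC _ (fun f => word_weight half f) (fun f => fourier_exp t (fpsum S f))).
have -> : \sum_(f : {ffun 'I_n -> bool})
    (word_weight half f)%:C * fourier_exp t (fpsum S f) =
   \prod_(i < n) \sum_(b : bool) half%:C * fourier_exp t ((S i && b)%:R / 2 ^+ i.+1).
  rewrite bigA_distr_bigA /=; apply: eq_bigr => f _.
  rewrite big_split /=; congr (_ * _).
    rewrite /word_weight rmorph_prod; apply: eq_bigr => i _.
    by rewrite /weight /half; case: (f i) => //; congr (_%:C); field.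
  rewrite /fpsum; apply: (big_morph (fourier_exp t)).
    exact: fourier_expDx.
  exact: fourier_exp_x0.
have nprod (r : seq 'I_n) (F : 'I_n -> R[i]) :
    Normc.normc (\prod_(i <- r) F i) ^+ 2 = \prod_(i <- r) (Normc.normc (F i) ^+ 2).
  elim: r => [|i r IH]; first by rewrite !big_nil Normc.normc1 expr1n.
  by rewrite !big_cons sqr_normcM IH.
rewrite nprod /cosprod [RHS]big_mkcond; apply: eq_bigr => i _.
rewrite big_bool andbT andbF mul0r fourier_exp_x0 mulr1.
case: (S i); last first.
  rewrite mul0r fourier_exp_x0 mulr1 sqr_normcE /= /half.
  by field.
have -> : pi * t / 2 ^+ i.+1 = pi * t * (1 / 2 ^+ i.+1) by rewrite mul1r.
move: (1 / _) => x; rewrite sqr_normcE /= /half.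
have -> : 2 * pi * t * x = (pi * t * x) *+ 2 by rewrite -mulr_natl; ring.
rewrite cos_mulr2n sin_mulr2n.
have := cos2Dsin2 (pi * t * x).
move: (cos _) (sin _) => c s h.
have hs : s ^+ 2 = 1 - c ^+ 2 by rewrite -h; ring.
have -> : (2^-1 * (c ^+ 2 *+ 2 - 1) - 0 * ((c * s) *+ 2) + 2^-1) ^+ 2 +
   (2^-1 * ((c * s) *+ 2) + 0 * (c ^+ 2 *+ 2 - 1) + 0) ^+ 2 =
   c ^+ 2 * (c ^+ 2 + s ^+ 2) by field.
by rewrite hs; ring.
Qed.

Lemma binlaw_fourier S (t : R) :
  cosprod S n t @[n --> \oo] --> Normc.normc (fourier_coef (binlaw S) t) ^+ 2.
Proof.
have comp (g : R -> R) : continuous g -> (forall x, `|g x| <= 1) ->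
   \int[uniform01]_y g (psum (thin S y) n) @[n --> \oo] --> \int[binlaw S]_x g x.
  move=> cg g1.
  have mg : measurable_fun [set: measurableTypeR R]
      (g : measurableTypeR R -> measurableTypeR R).
    exact: continuous_measurable_fun.
  have mgb : measurable_fun [set: measurableTypeR R] (fun y => g (binmap S y)).
    exact: (measurableT_comp mg (measurable_binmap S)).
  have bd (h : R -> R) : measurable_fun [set: measurableTypeR R] h ->
      (forall x, `|h x| <= 1) ->
      uniform01.-integrable [set: measurableTypeR R] (EFin \o h).
    move=> mh h1; apply: measurable_bounded_integrable => //.
      by rewrite [X in (X < _)%E]uniform01_setT ltry.
    exists 1; split; first exact: num_real.
    by move=> y y1 x _ /=; apply: le_trans (h1 x) (ltW y1).
  have ig : uniform01.-integrable [set: measurableTypeR R]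
      (EFin \o (fun y => g (binmap S y))).
    exact: bd.
  have -> : \int[binlaw S]_x g x = \int[uniform01]_y g (binmap S y).
    rewrite /Rintegral; congr fine.
    have := @integral_pushforward _ _ (measurableTypeR R) (measurableTypeR R) R (binmap S)
      (measurable_binmap S) uniform01 setT (EFin \o g).
    by rewrite preimage_setT => -> //; exact/measurable_EFinP.
  rewrite /Rintegral.
  apply: fine_cvg; rewrite fineK; last exact: integrable_fin_num.
  apply: (@dominated_cvg _ _ _ uniform01 setT measurableT
    (fun n y => (g (psum (thin S y) n))%:E) (fun y => (g (binmap S y))%:E) (cst 1%E)) => //.
  - move=> n; apply/measurable_EFinP; under eq_fun do rewrite psum_thinE.
    exact: (measurable_digits _ (fun f => g (fpsum S f))).
  - move=> y _; apply: cvg_EFin; first exact: nearW.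
    by apply: continuous_cvg; [exact: cg|exact: psum_cvg].
  - by apply: (bd (cst 1)) => // x; rewrite normr1.
  - by move=> n y _ /=; rewrite lee_fin.
have cc : continuous (fun x : R => cos (2 * pi * t * x)).
  move=> x; apply: continuous_comp; last exact: continuous_cos.
  exact: mulrl_continuous.
have cs : continuous (fun x : R => sin (2 * pi * t * x)).
  move=> x; apply: continuous_comp; last exact: continuous_sin.
  exact: mulrl_continuous.
have c1 := comp _ cc (fun x => cos_max _).
have c2 := comp _ cs (fun x => sin_max _).
rewrite sqr_normcE /=.
have -> : (fun n => cosprod S n t) = (fun n =>
   (\int[uniform01]_y cos (2 * pi * t * psum (thin S y) n)) *
   (\int[uniform01]_y cos (2 * pi * t * psum (thin S y) n)) +
   (\int[uniform01]_y sin (2 * pi * t * psum (thin S y) n)) *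
   (\int[uniform01]_y sin (2 * pi * t * psum (thin S y) n))).
  by apply/funext => n; rewrite -partial_fourier sqr_normcE /= !expr2.
by rewrite !expr2; apply: cvgD; apply: cvgM.
Qed.

Lemma binlaw_spectral S : spectral_measure (binlaw S).
Proof.
apply: cosprod_spectral; first exact: binlaw_setT.
exact: binlaw_fourier.
Qed.

End binary_law.

(** * Masses of intervals *)

Section cell_mass.
Context {R : realType}.
Implicit Types (S b c : nat -> bool) (n : nat).

Lemma psum_ltd b c n i : (i < n)%N -> (forall j, (j < i)%N -> b j = c j) ->
  b i -> ~~ c i -> (psum c n < psum b n :> R).
Proof.
move=> ilt bc bi ci.
have e : psum c i = psum b i :> R.
  by apply: eq_bigr => j _; rewrite bc.
apply: lt_le_trans (_ : psum b i.+1 <= _); last exact: psum_nd.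
rewrite -(subnKC ilt); apply: le_lt_trans (psum_tail _ _ _) _.
rewrite !psumS bi (negbTE ci) e mul0r addr0 mul1r.
by rewrite ltrBlDr ltrDl invr_gt0 exprn_gt0.
Qed.

(** Two finite binary expansions of the same length with equal values have the same
    digits. *)
Lemma psum_inj b c n : psum b n = psum c n :> R ->
  forall i, (i < n)%N -> b i = c i.
Proof.
move=> e; elim/ltn_ind => i IH ilt.
have bc j : (j < i)%N -> b j = c j by move=> ji; apply: IH => //; exact: ltn_trans ilt.
case bi: (b i); case ci: (c i) => //.
  by have := psum_ltd ilt bc bi (negbT ci); rewrite e ltxx.
have := psum_ltd ilt (fun j ji => esym (bc j ji)) ci (negbT bi).
by rewrite e ltxx.
Qed.

Definition card_upto S n : nat := \sum_(i < n) S i.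

Lemma measurable_psum_fiber S n (v : R) :
  measurable [set y : measurableTypeR R | psum (thin S y) n = v].
Proof.
rewrite (_ : [set y | _] = (fun y => fpsum S (digits half n y)) @^-1` [set v]).
  rewrite -[X in measurable X]setTI.
  exact: (@measurable_digits R half n (@fpsum R S n)).
by apply/seteqP; split => y /=; rewrite psum_thinE.
Qed.

(** A value of the partial sum determines the first [n] digits at the positions in
    [S], and each of these digits is prescribed with probability 1/2. *)
Lemma psum_fiber_mass S n (v : R) :
  (uniform01 [set y : measurableTypeR R | psum (thin S y) n = v] <=
    (2 ^- card_upto S n)%:E)%E.
Proof.
have [[y0 y0v]|none] := pselect (exists y : R, psum (thin S y) n = v); last first.
  rewrite (_ : [set y : R | _] = set0) ?measure0 ?lee_fin ?invr_ge0 ?exprn_ge0//.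
  by rewrite -subset0 => y yv; apply: none; exists y.
pose c := digit (half : R) ^~ y0.
pose F (f : {ffun 'I_n -> bool}) : R := \prod_(i < n) (S i ==> (f i == c i))%:R.
have mA := measurable_psum_fiber S n v.
have sub y : psum (thin S y) n = v -> F (digits half n y) = 1.
  rewrite -y0v => /psum_inj H; rewrite /F big1// => i _; rewrite ffunE.
  by have := H i (ltn_ord i); rewrite /thin /c; case: (S i) => //= ->; rewrite eqxx.
have F0 f : 0 <= F f by apply: prodr_ge0.
apply: le_trans (_ : \int[uniform01]_y (F (digits half n y))%:E <= _)%E.
  set A := [set y | _] in mA *.
  have -> : uniform01 A = (\int[uniform01]_y (\1_A y)%:E)%E.
    by rewrite integral_indic// setIT.
  apply: ge0_le_integral => //.
  - by apply/measurable_EFinP; exact: measurable_indic.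
  - by apply/measurable_EFinP; exact: measurable_digits.
  - move=> y _; rewrite lee_fin indicE.
    have [yv|] := boolP (y \in _); last by [].
    by rewrite sub//; move: yv; rewrite inE.
have iF := @integrable_digits R half n F.
rewrite -[leLHS]fineK; last exact: integrable_fin_num.
rewrite -/(Rintegral _ _ _) lee_fin (integral_digits half01 F).
rewrite /F /word_weight; under eq_bigr do rewrite -big_split /=.
rewrite -(bigA_distr_bigA (fun (i : 'I_n) (d : bool) =>
  weight half d * (S i ==> (d == c i))%:R)) /=.
rewrite /card_upto.
have -> : 2 ^- (\sum_(i < n) S i) = \prod_(i < n) (2 ^- (S i)) :> R.
  by rewrite prodfV -expr_sum.
apply: ler_prod => i _; rewrite big_bool /weight /half.
by case: (S i); case: (c i); rewrite /= ?expr1 ?expr0; apply/andP; split; lra.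
Qed.

Lemma psum_natmul b n : exists m : nat, psum b n = m%:R / 2 ^+ n :> R.
Proof.
elim: n => [|n [m e]]; first by exists 0%N; rewrite /psum big_ord0 mul0r.
exists (m.*2 + b n)%N; rewrite psumS e exprS natrD -muln2 natrM.
by field; rewrite expf_neq0.
Qed.

(** If [X_S] lies in the interval, its partial sum lies in an interval of length
    [2 * 2^-n]; partial sums are multiples of [2^-n], so at most three values occur. *)
Lemma binlaw_interval S n (a d : R) : d <= 2 ^- n ->
  (binlaw S (`[a, (a + d)%R]%classic : set R) <= (3 * 2 ^- card_upto S n)%:E)%E.
Proof.
move=> dn.
have p2 : 0 < 2 ^+ n :> R by rewrite exprn_gt0.
(* [z 2^-n] is the least multiple of [2^-n] that the partial sum can equal. *)
pose z := Num.ceil ((a - 2 ^- n) * 2 ^+ n).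
pose V (j : nat) : set (measurableTypeR R) :=
  [set y | psum (thin S y) n = (z + j%:Z)%:~R / 2 ^+ n :> R].
have mV j : measurable (V j) by exact: measurable_psum_fiber.
have mI : measurable (`[a, (a + d)%R]%classic : set (measurableTypeR R)).
  exact: measurable_itv.
have sub : binmap S @^-1` `[a, (a + d)%R]%classic `<=` \big[setU/set0]_(j < 3) V j.
  move=> y; rewrite /= in_itv /= => /andP[ay ya].
  have h1 := binval_ge (R := R) (thin S y) n.
  have h2 := binval_le (R := R) (thin S y) n.
  have [m em] := psum_natmul (thin S y) n.
  have a1 : a - 2 ^- n <= m%:R / 2 ^+ n.
    by rewrite -em lerBlDr; apply: le_trans ay _; exact: h2.
  have a2 : m%:R / 2 ^+ n <= a + 2 ^- n.
    by rewrite -em; apply: le_trans h1 _; apply: le_trans ya _; rewrite lerD2l.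
  have z1 : (z <= m%:Z)%R by rewrite ceil_le_int -ler_pdivlMr.
  have z2 : (m%:Z <= z + 2)%R.
    rewrite -(ler_int R) rmorphD /=.
    have := ceil_ge ((a - 2 ^- n) * 2 ^+ n); rewrite -/z.
    rewrite mulrBl mulVf ?gt_eqF//.
    by move: a2; rewrite ler_pdivrMr// mulrDl mulVf ?gt_eqF// => ? ?; lra.
  have : exists j : 'I_3, m%:Z = z + j%:Z.
    have [k ek] : exists k : nat, m%:Z - z = k%:Z.
      by exists `|m%:Z - z|%N; rewrite gez0_abs// subr_ge0.
    have k3 : (k < 3)%N by rewrite -ltz_nat -ek; lia.
    by exists (Ordinal k3); rewrite /= -ek addrC subrK.
  by move=> [j ej]; rewrite -bigcup_mkord; exists j => //=; rewrite /V /= em -ej.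
apply: le_trans (_ : uniform01 (\big[setU/set0]_(j < 3) V j) <= _)%E.
  rewrite /binlaw /distribution /= /pushforward; apply: le_measure; rewrite ?inE//.
    by rewrite -[X in measurable X]setTI; exact: measurable_binmap.
  by apply: bigsetU_measurable => j _; exact: mV.
apply: le_trans (_ : \sum_(j < 3) uniform01 (V j) <= _)%E.
  by apply: content_subadditive => //; apply: bigsetU_measurable => j _; exact: mV.
apply: le_trans (_ : \sum_(j < 3) (2 ^- card_upto S n)%:E <= _)%E.
  by apply: lee_sum => j _; exact: psum_fiber_mass.
by rewrite sumEFin lee_fin sumr_const card_ord mulr_natl.
Qed.

End cell_mass.

(** * Hausdorff dimension of the law *)

Section dimension.
Context {R : realType}.
Implicit Types (S : nat -> bool) (n : nat) (U E : set R) (sigma : R).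

Lemma le_diameter U x y : U x -> U y -> (`|x - y|%:E <= diameter U)%E.
Proof. by move=> Ux Uy; apply: ereal_sup_ubound; exists (x, y). Qed.

Lemma diameter_itv (a r : R) : 0 <= r -> (diameter `[a, (a + r)%R]%classic <= r%:E)%E.
Proof.
move=> r0; apply: ge_ereal_sup => _ [[x y] /= [+ +] <-].
rewrite !in_itv /= => /andP[ax xa] /andP[ay ya].
by rewrite lee_fin ler_norml; apply/andP; split; lra.
Qed.

Lemma diameter_set0 : diameter (set0 : set R) = -oo%E.
Proof.
rewrite /diameter (_ : [set _ | _ in _] = set0) ?ereal_sup0//.
by rewrite -subset0 => _ [[x y] [] //].
Qed.

Lemma diameter_pow_ge0 sigma U : (0 <= diameter_pow sigma U)%E.
Proof. by rewrite /diameter_pow; case: pselect => // _; exact: poweR_ge0. Qed.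

Lemma diameter_pow0 sigma : diameter_pow sigma (set0 : set R) = 0%E.
Proof. by rewrite /diameter_pow; case: pselect. Qed.

Lemma exp2_powR n : 2 ^- n = 2 `^ (- n%:R) :> R.
Proof. by rewrite powRN powR_mulrn. Qed.

Lemma exp2N_powR n sigma : (2 ^- n) `^ sigma = 2 `^ (- (sigma * n%:R)) :> R.
Proof. by rewrite exp2_powR -powRrM mulNr mulrC. Qed.

Lemma powR2_gt1 sigma : 0 < sigma -> 1 < 2 `^ sigma :> R.
Proof.
move=> s0; have := @gt0_ltr_powR R sigma s0 1 2.
by rewrite powR1 !nnegrE; apply=> //; rewrite ltr1n.
Qed.

Lemma exists_dyadic (n0 : nat) (e : R) : 0 < e -> e <= 2 ^- n0 ->
  exists n, [/\ (n0 <= n)%N, 2 ^- n.+1 < e & e <= 2 ^- n].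
Proof.
move=> e0 en0.
have ex : exists k, 2 ^- k < e.
  have /cvgrPdist_lt/(_ _ e0) [k _ /(_ k (leqnn k))] : 2^-1 ^+ k @[k --> \oo] --> (0 : R).
    by apply: cvg_expr; rewrite ger0_norm; lra.
  by rewrite sub0r normrN ger0_norm ?exprn_ge0// exprVn; exists k.
have [k hk hmin] := ex_minnP ex.
have nk : (n0 < k)%N.
  rewrite ltnNge; apply/negP => kn; have := lt_le_trans hk en0.
  by rewrite ltf_pV2 ?posrE ?exprn_gt0// ltr_eXn2l ?ltr1n// ltnNge kn.
exists k.-1; rewrite prednK ?(leq_ltn_trans _ nk)//; split=> //.
  by rewrite -ltnS prednK// (leq_ltn_trans _ nk).
rewrite leNgt; apply/negP => /hmin.
by rewrite -ltnS prednK ?ltnn// (leq_ltn_trans _ nk).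
Qed.

(** A set of diameter [d > 0] lies in an interval of length [2 d]; at the dyadic scale
    [2^-(n+1) < 2 d <= 2^-n] its mass is at most
    [3 * 2^-(|S_n|) <= 3 * 2^-(sigma n) <= 3 * (4 d)^sigma].  A point has mass zero
    when [sigma > 0], and [0^0 = 1] suffices when [sigma = 0]. *)
Lemma mass_cover S sigma n0 U : 0 <= sigma ->
  (forall n, (n0 <= n)%N -> sigma * n%:R <= (card_upto S n)%:R) ->
  (diameter U <= (2 ^- n0.+1)%:E)%E ->
  exists V : set (measurableTypeR R), [/\ measurable V, U `<=` V &
    (binlaw S V <= (3 * 4 `^ sigma)%:E * diameter_pow sigma U)%E].
Proof.
move=> sigma0 H dU.
have cardle n : (n0 <= n)%N -> 2 ^- card_upto S n <= (2 ^- n) `^ sigma.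
  by move=> nn; rewrite [leLHS]exp2_powR exp2N_powR ler_powR ?ler1n// lerN2; exact: H.
have C1 : 1 <= 4 `^ sigma :> R by rewrite -[leLHS](powRr0 4) ler_powR// ler1n.
have [U0|/set0P[x Ux]] := eqVneq U set0.
  exists set0; split => //; first by rewrite U0.
  by rewrite measure0 U0 diameter_pow0 mule0.
have dge0 : (0%:E <= diameter U)%E by rewrite -(normr0 R) -(subrr x) le_diameter.
have dfin : diameter U \is a fin_num.
  by rewrite ge0_fin_numE// (le_lt_trans dU)// ltry.
pose d := fine (diameter U).
have dE : diameter U = d%:E by rewrite fineK.
rewrite dE !lee_fin in dge0 dU.
exists `[(x - d)%R, (x - d + 2 * d)%R]%classic; split => //.
  move=> y Uy /=; rewrite in_itv /=.
  have : `|x - y| <= d by rewrite -lee_fin -dE; exact: le_diameter.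
  by rewrite ler_norml => /andP[? ?]; apply/andP; split; lra.
have -> : diameter_pow sigma U = (d `^ sigma)%:E.
  rewrite /diameter_pow; case: pselect => [U0|_]; first by rewrite U0 in Ux.
  by rewrite dE poweR_EFin.
rewrite -EFinM.
have [d0|dpos] := eqVneq d 0; last first.
  have {}dpos : 0 < d by rewrite lt_neqAle eq_sym dpos.
  have e0 : 0 < 2 * d by rewrite mulr_gt0.
  have en : 2 * d <= 2 ^- n0.
    by move: dU; rewrite exprS invfM => h; lra.
  have [n [nn n1 n2]] := exists_dyadic e0 en.
  apply: le_trans (binlaw_interval S (x - d) n2) _; rewrite lee_fin.
  rewrite -mulrA ler_wpM2l//; apply: le_trans (cardle _ nn) _.
  rewrite -powRM//; apply: ge0_ler_powR => //;
    rewrite ?nnegrE ?invr_ge0 ?exprn_ge0 ?mulr_ge0//.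
  by move: n1; rewrite exprS invfM => h; lra.
have [s0|spos] := eqVneq sigma 0.
  rewrite s0 !powRr0 !mulr1; apply: le_trans (probability_le1 _ _) _ => //.
  by rewrite lee_fin ler1n.
have {}spos : 0 < sigma by rewrite lt_neqAle eq_sym spos.
rewrite d0 powR0 ?gt_eqF// mulr0 mulr0 subr0.
set V := [set` _].
have Vfin : binlaw S V \is a fin_num by apply: fin_num_measure; exact: measurable_itv.
rewrite -(fineK Vfin) lee_fin.
pose r : R := 2 `^ (- sigma).
have r0 : 0 <= r by exact: powR_ge0.
have r1 : r < 1.
  by rewrite /r powRN invf_lt1 ?powR_gt0//; exact: powR2_gt1.
have c : 3 * r ^+ n @[n --> \oo] --> 3 * (0 : R).
  by apply: cvgM; [exact: cvg_cst|apply: cvg_expr; rewrite ger0_norm].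
rewrite mulr0 in c; rewrite -(cvg_lim _ c)//; apply: limr_ge.
  by apply/cvg_ex; eexists; exact: c.
near=> n.
rewrite -lee_fin fineK//.
have h : 0 <= 2 ^- n :> R by rewrite invr_ge0 exprn_ge0.
apply: le_trans (binlaw_interval S x h) _; rewrite lee_fin ler_wpM2l//.
apply: le_trans (cardle n _) _; first by near: n; exact: nbhs_infty_ge.
by rewrite exp2N_powR /r -powR_mulrn ?powR_ge0// -powRrM mulNr.
Unshelve. all: by end_near. Qed.

(** Mass distribution principle: any cover of [E] by small sets has total
    [sigma]-th power of diameters at least a constant times the mass of [E]. *)
Lemma hausdorff_measure_neq0 S sigma n0 (E : set (measurableTypeR R)) : 0 <= sigma ->
  (forall n, (n0 <= n)%N -> sigma * n%:R <= (card_upto S n)%:R) ->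
  measurable E -> (0 < binlaw S E)%E -> hausdorff_measure sigma E <> 0%E.
Proof.
move=> sigma0 H mE E0.
pose C : R := 3 * 4 `^ sigma.
have C0 : 0 < C by rewrite mulr_gt0// powR_gt0.
pose delta : R := 2 ^- n0.+1.
have delta0 : 0 < delta by rewrite invr_gt0 exprn_gt0.
have content : (C^-1%:E * binlaw S E <= hausdorff_content sigma delta E)%E.
  apply: le_ereal_inf_tmp => _ [U [EU dU] <-].
  have [V HV] := choice (fun n => mass_cover sigma0 H (dU n)).
  rewrite lee_pdivrMl//.
  rewrite -nneseriesZl; last by move=> n _; exact: diameter_pow_ge0.
  apply: le_trans (_ : \sum_(0 <= n <oo) binlaw S (V n) <= _)%E.
    apply: measure_sigma_subadditive => //.
      by move=> n; case: (HV n).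
    move=> y /EU [n _ Uy]; exists n => //.
    by case: (HV n) => _ + _; apply.
  by apply: lee_nneseries => // n _; case: (HV n).
move=> h0.
have : (hausdorff_content sigma delta E <= 0)%E.
  by rewrite -h0; apply: ereal_sup_ubound; exists delta.
apply/negP; rewrite -ltNge; apply: lt_le_trans content.
by rewrite mule_gt0// lte_fin invr_gt0.
Qed.

(** The left endpoints of the intervals of generation [n], so that their number can
    be read off the recursion. *)
Fixpoint left_endpoints S n : seq R :=
  if n is m.+1 then
    left_endpoints S m ++
    (if S m then [seq x + 2 ^- m.+1 | x <- left_endpoints S m] else [::])
  else [:: 0].

Lemma size_left_endpoints S n : size (left_endpoints S n) = (2 ^ card_upto S n)%N.
Proof.
rewrite /card_upto; elim: n => [|n IH]; first by rewrite big_ord0.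
rewrite big_ord_recr /= size_cat IH; case: (S n); last by rewrite !addn0.
by rewrite size_map IH addn1 expnS mul2n addnn.
Qed.

Lemma psum_left_endpoints S (y : R) n : psum (thin S y) n \in left_endpoints S n.
Proof.
elim: n => [|n IH] /=; first by rewrite /psum big_ord0 inE.
rewrite psumS mem_cat.
have -> : thin S y n = S n && digit half n y by [].
case: (S n) => /=; last by rewrite mul0r addr0 IH.
case: (digit half n y); last by rewrite mul0r addr0 IH.
by rewrite mul1r (map_f (fun x => x + 2 ^- n.+1) IH) orbT.
Qed.

Definition limit_set S : set (measurableTypeR R) :=
  \bigcap_n \big[setU/set0]_(x <- left_endpoints S n) `[x, (x + 2 ^- n)%R]%classic.

Lemma measurable_limit_set S : measurable (limit_set S).
Proof.
apply: bigcapT_measurable => n; apply: bigsetU_measurable => x _.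
exact: measurable_itv.
Qed.

Lemma binlaw_limit_set S : binlaw S (limit_set S) = 1%E.
Proof.
rewrite /binlaw /distribution /= /pushforward.
rewrite (_ : _ @^-1` _ = setT) ?uniform01_setT//; apply/seteqP; split => // y _ /=.
move=> n _; rewrite -bigcup_seq; exists (psum (thin S y) n) => /=.
  exact: psum_left_endpoints.
by rewrite in_itv /= binval_ge binval_le.
Qed.

(** Generation [n] covers with [2^(|S_n|)] intervals of length [2^-n], whose sum
    of [sigma]-th powers is at most [2^((sigma' - sigma) n)]. *)
Lemma hausdorff_measure_limit_set S sigma sigma' n0 : 0 <= sigma -> sigma' < sigma ->
  (forall n, (n0 <= n)%N -> (card_upto S n)%:R <= sigma' * n%:R) ->
  hausdorff_measure sigma (limit_set S) = 0%E.
Proof.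
move=> sigma0 ss H.
apply/eqP; rewrite eq_le; apply/andP; split; last first.
  apply: le_trans (_ : hausdorff_content sigma 1 (limit_set S) <= _)%E.
    apply: le_ereal_inf_tmp => _ [U _ <-].
    by apply: nneseries_ge0 => n _ _; exact: diameter_pow_ge0.
  by apply: ereal_sup_ubound; exists 1 => //=.
apply: ge_ereal_sup => _ [delta /= delta0 <-].
apply/lee_addgt0Pr => eps eps0; rewrite add0e.
pose r : R := 2 `^ (sigma' - sigma).
have r0 : 0 <= r by exact: powR_ge0.
have r1 : r < 1.
  by rewrite /r -opprB powRN invf_lt1 ?powR_gt0// powR2_gt1// subr_gt0.
have c1 : r ^+ n @[n --> \oo] --> (0 : R) by apply: cvg_expr; rewrite ger0_norm.
have c2 : 2^-1 ^+ n @[n --> \oo] --> (0 : R) by apply: cvg_expr; rewrite ger0_norm; lra.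
have /cvgrPdist_lt/(_ _ eps0) n1 := c1.
have /cvgrPdist_lt/(_ _ delta0) n2 := c2.
have [n [nn0 rn dn]] : exists n, [/\ (n0 <= n)%N, r ^+ n <= eps & 2 ^- n <= delta].
  near \oo => n; exists n; split; first by near: n; exact: nbhs_infty_ge.
    by rewrite ltW// -[ltLHS]ger0_norm ?exprn_ge0// -normrN -sub0r; near: n.
  by rewrite ltW// -exprVn -[ltLHS]ger0_norm ?exprn_ge0// -normrN -sub0r; near: n.
have p2 : 0 <= 2 ^- n :> R by rewrite invr_ge0 exprn_ge0.
pose U k : set R := if (k < size (left_endpoints S n))%N then
   `[nth 0 (left_endpoints S n) k, (nth 0 (left_endpoints S n) k + 2 ^- n)%R]%classic
   else set0.
apply: ge_ereal_inf; exists (\sum_(0 <= k <oo) diameter_pow sigma (U k))%E.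
  exists U => //; split.
    move=> y /(_ n I); rewrite -bigcup_seq => -[x /= xp xy].
    exists (index x (left_endpoints S n)) => //.
    by rewrite /U index_mem xp nth_index.
  move=> k; rewrite /U; case: ifP => _; last by rewrite diameter_set0 leNye.
  by apply: le_trans (diameter_itv _ p2) _; rewrite lee_fin.
rewrite (nneseries_split 0 (size (left_endpoints S n))); last first.
  by move=> k _; exact: diameter_pow_ge0.
rewrite add0n eseries0 ?adde0; last first.
  by move=> k kn _; rewrite /U ltnNge kn /= diameter_pow0.
apply: le_trans
  (_ : \sum_(0 <= k < size (left_endpoints S n)) ((2 ^- n) `^ sigma)%:E <= _)%E.
  apply: lee_sum => k _; rewrite /U; case: ifP => _; last first.
    by rewrite diameter_pow0 lee_fin powR_ge0.
  rewrite /diameter_pow; case: pselect => [_|_]; first by rewrite lee_fin powR_ge0.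
  rewrite -poweR_EFin; set I := [set` _].
  have I0 : (0 <= diameter I)%E.
    have Ix : I (nth 0 (left_endpoints S n) k) by rewrite /I /= in_itv /= lexx lerDl.
    rewrite -[0%E]/(0%:E) -(normr0 R).
    by rewrite -(subrr (nth 0 (left_endpoints S n) k)) le_diameter.
  apply: gt0_ler_poweR => //; rewrite ?in_itv /= ?leey ?andbT ?lee_fin//.
  exact: diameter_itv.
rewrite sumEFin lee_fin big_const_nat iter_addr_0 subn0 size_left_endpoints.
rewrite -[leLHS]mulr_natr [X in _ * X](_ : _ = 2 `^ (card_upto S n)%:R); last first.
  by rewrite powR_mulrn// natrX.
rewrite exp2N_powR -powRD ?pnatr_eq0 ?implybT//.
apply: le_trans rn; rewrite /r -powR_mulrn ?powR_ge0// -powRrM.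
apply: ler_powR; first by rewrite ler1n.
by rewrite mulrBl addrC lerD2r; exact: H.
Unshelve. all: by end_near. Qed.

(** The density of [S] lies between any [sigma' < s] and any [sigma > s] from some scale on;
    the first gives the lower bound for all sets of positive mass, the second the
    upper bound for the limit set, which has full mass. *)
Lemma binlaw_dim S (s : R) : 0 < s ->
  (card_upto S n)%:R / n%:R @[n --> \oo] --> s ->
  hausdorff_dim_measure (binlaw S) = s%:E.
Proof.
move=> s0 dens.
have lower sigma : sigma < s -> exists n0, forall n, (n0 <= n)%N ->
    sigma * n%:R <= (card_upto S n)%:R.
  move=> ss; have /cvgrPdist_lt/(_ (s - sigma)) := dens.
  rewrite subr_gt0 => /(_ ss) [n0 _ h]; exists n0 => n /h /=.
  have [->|n0'] := posnP n; first by rewrite mulr0.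
  rewrite ltr_norml => /andP[_ ?]; rewrite -ler_pdivlMr ?ltr0n//; lra.
have upper sigma : s < sigma -> exists n0, forall n, (n0 <= n)%N ->
    (card_upto S n)%:R <= sigma * n%:R.
  move=> ss; have /cvgrPdist_lt/(_ (sigma - s)) := dens.
  rewrite subr_gt0 => /(_ ss) [n0 _ h]; exists n0 => n /h /=.
  have [->|n0'] := posnP n; first by rewrite mulr0 /card_upto big_ord0.
  rewrite ltr_norml => /andP[? _]; rewrite -ler_pdivrMr ?ltr0n//; lra.
apply/eqP; rewrite eq_le; apply/andP; split.
  apply: ge_ereal_inf; exists (hausdorff_dim (limit_set S)).
    exists (limit_set S) => //; split; first exact: measurable_limit_set.
    by rewrite [X in (_ < X)%E]binlaw_limit_set.
  apply/lee_addgt0Pr => eps eps0.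
  have [n0 h] := upper (s + eps / 2) ltac:(lra).
  apply: ereal_inf_lbound; exists (s + eps) => //; split => /=; first lra.
  apply: (hausdorff_measure_limit_set _ _ h); lra.
apply: le_ereal_inf_tmp => _ [E [mE E0] <-].
apply: le_ereal_inf_tmp => _ [sigma [sigma0 h] <-].
rewrite lee_fin leNgt; apply/negP => ss; have [n0 hn] := lower _ ss.
exact: hausdorff_measure_neq0 sigma0 hn mE E0 h.
Qed.

End dimension.

(** * The random measure and the Bernoulli measures *)

Section kernel.
Context {R : realType}.

(** The set of indices attached to a sequence: the positions of the letter 1. *)
Definition ones (w : nat -> posint) : nat -> bool := fun i => val (w i) == 1%N.

(** A letter is constant on small balls, the distance being ultrametric. *)
Lemma open_letter i (A : set posint) : open [set w : Omega R | A (w i)].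
Proof.
rewrite openE => w /= Aw; rewrite /interior /=; apply/nbhs_ballP.
exists (2 ^- i) => /=; first by rewrite invr_gt0 exprn_gt0.
by move=> v; rewrite ballEmdist /= => /(Omega_dist_lt w v i) /(_ i (leqnn i)) <-.
Qed.

Lemma measurable_letter i (A : set posint) :
  measurable [set w : borel_Omega R | A (w i)].
Proof. by apply: sub_sigma_algebra; exact: open_letter. Qed.

Lemma measurable_ones i :
  measurable_fun [set: borel_Omega R] (fun w : borel_Omega R => ones w i).
Proof.
apply: (measurable_fun_bool true); rewrite setTI.
exact: (measurable_letter i [set a | val a == 1%N]).
Qed.

Definition random_law (w : borel_Omega R) : {measure set (measurableTypeR R) -> \bar R} :=
  binlaw (ones w).

Lemma measurable_joint_binmap :
  measurable_fun [set: borel_Omega R * measurableTypeR R]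
    (fun wy : borel_Omega R * measurableTypeR R => binmap (ones wy.1) wy.2).
Proof.
apply: (@measurable_fun_cvg _ (borel_Omega R * measurableTypeR R)%type R setT
  (fun n wy => psum (thin (ones wy.1) wy.2) n)); last first.
  by move=> wy _; exact: psum_cvg.
move=> n; apply: measurable_sum => i; apply: measurable_funM; last exact: measurable_cst.
under eq_fun => wy.
  rewrite (_ : (thin _ _ i)%:R = if thin (ones wy.1) wy.2 i then 1 else 0 :> R); last first.
    by case: (thin _ _ _).
  over.
apply: measurable_fun_ifT; [|exact: measurable_cst..].
apply: measurable_and.
  exact: (measurableT_comp (measurable_ones i) measurable_fst).
exact: (measurableT_comp (measurable_digit half i) measurable_snd).
Qed.

(** The law of [binmap (ones w)] evaluated at [U] is the measure of a section of a
    set that is jointly measurable in [w] and the uniform point. *)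
Lemma measurable_random_law (U : set (measurableTypeR R)) : measurable U ->
  measurable_fun [set: borel_Omega R] (random_law ^~ U).
Proof.
move=> mU.
pose A := (fun wy : borel_Omega R * measurableTypeR R => binmap (ones wy.1) wy.2) @^-1` U.
have mA : measurable A.
  by rewrite -[A]setTI; exact: measurable_joint_binmap.
have := @measurable_fun_xsection _ _ _ _ _ (@uniform01 R) A mA.
congr measurable_fun; apply/funext => w /=.
rewrite /random_law /binlaw /distribution /= /pushforward; congr (uniform01 _).
by rewrite /xsection; apply/seteqP; split => y /=; rewrite inE.
Qed.

HB.instance Definition _ := isKernel.Build _ _ (borel_Omega R) (measurableTypeR R) R
  random_law measurable_random_law.

Definition random_kernel : R.-ker (borel_Omega R) ~> (measurableTypeR R) := random_law.

End kernel.

Section bernoulli.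
Context {R : realType} (p : R).
Hypothesis p01 : 0 < p < 1.

Definition letter (b : bool) : posint :=
  if b then exist _ 1%N isT else exist _ 2%N isT.

Definition coding (y : measurableTypeR R) : borel_Omega R := fun i => letter (digit p i y).

Lemma ones_coding y : ones (coding y) = digit p ^~ y.
Proof. by apply/funext => i; rewrite /ones /coding; case: (digit _ _ _). Qed.

(** An open set of sequences is a countable union of cylinders, and a cylinder
    pulls back to a set of points with prescribed first digits. *)
Lemma measurable_coding : measurable_fun [set: measurableTypeR R] coding.
Proof.
apply: (@measurability _ _ (measurableTypeR R) (borel_Omega R) setT coding
  (@open (Omega R))) => //.
move=> _ [U oU <-]; rewrite setTI.
pose Q n (f : {ffun 'I_n -> bool}) :=
  forall v : Omega R, (forall i : 'I_n, v i = letter (f i)) -> U v.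
rewrite (_ : _ @^-1` _ =
    \bigcup_n \bigcup_(f in [set f | Q n f]) [set y | digits p n y = f]).
  apply: bigcupT_measurable => n; apply: fin_bigcup_measurable; first exact: finite_finset.
  by move=> f _; exact: measurable_cyl.
apply/seteqP; split => y /=.
  move=> Uy; have : nbhs (coding y : Omega R) U by move: oU; rewrite openE => /(_ _ Uy).
  move=> /nbhs_ballP[e /= e0 eU].
  have /cvgrPdist_lt/(_ _ e0) [n _ /(_ n (leqnn n))] : 2^-1 ^+ k @[k --> \oo] --> (0 : R).
    by apply: cvg_expr; rewrite ger0_norm; lra.
  rewrite sub0r normrN ger0_norm ?exprn_ge0// exprVn => ne.
  exists n.+1 => //; exists (digits p n.+1 y) => //.
  move=> v Hv; apply: eU; rewrite ballEmdist /=; apply: lt_trans ne.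
  apply/Omega_dist_lt => i iltn.
  by have := Hv (Ordinal (iltn : (i < n.+1)%N)); rewrite ffunE.
move=> [n _ [f Qf fy]]; apply: Qf => i.
by rewrite /coding -fy ffunE.
Qed.

HB.instance Definition _ := isMeasurableFun.Build _ _
  (measurableTypeR R) (borel_Omega R) coding measurable_coding.

Definition bernoulli : probability (borel_Omega R) R :=
  distribution uniform01 (coding : {mfun measurableTypeR R >-> borel_Omega R}).

Definition letter_weight (j : nat) : R :=
  if j == 1%N then p else if j == 2%N then 1 - p else 0.

(** A word over the letters 1 and 2 prescribes the first digits of the uniform
    point; any other word has probability zero. *)
Lemma bernoulli_measureP : bernoulli_measure bernoulli.
Proof.
have /andP[p0 p1] := p01.
exists letter_weight; split.
- by move=> j _; rewrite /letter_weight; case: ifP => _; [|case: ifP => _]; lra.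
- rewrite (nneseries_split 1 2); last first.
    by move=> j _; rewrite lee_fin /letter_weight; case: ifP => _; [|case: ifP => _]; lra.
  rewrite eseries0; last by move=> [|[|[|j]]].
  rewrite adde0 (_ : (1 + 2)%N = 3%N)// (@big_ltn _ _ _ 1%N)// big_ltn// big_geq//.
  by rewrite adde0 /letter_weight /= -EFinD; congr EFin; ring.
move=> k alpha.
have [ok|/existsNP[i /negP]] :=
    pselect (forall i : 'I_k, val (tnth alpha i) \in [:: 1%N; 2%N]).
  pose f : {ffun 'I_k -> bool} := [ffun i => val (tnth alpha i) == 1%N].
  have lf i : letter (f i) = tnth alpha i.
    apply: val_inj; rewrite ffunE; have := ok i; rewrite !inE.
    by case: eqP => [->|_] //= /eqP ->.
  transitivity (uniform01 [set y | digits p k y = f]).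
    rewrite /bernoulli /distribution /= /pushforward; congr (uniform01 _).
    apply/seteqP; split => y /=.
      move=> H; apply/ffunP => i; rewrite !ffunE -H /coding.
      by case: (digit _ _ _).
    by move=> e i; rewrite -lf -e ffunE.
  rewrite uniform01_cyl//; congr EFin; apply: eq_bigr => i _.
  by rewrite -lf /letter_weight /weight; case: (f i).
rewrite !inE negb_or => /andP[i1 i2].
rewrite (bigD1 i)//= {1}/letter_weight (negbTE i1) (negbTE i2) mul0r.
rewrite /bernoulli /distribution /= /pushforward.
rewrite (_ : _ @^-1` _ = set0) ?measure0//.
rewrite -subset0 => y /= /(_ i) H; move: i1 i2; rewrite -H /coding.
by case: (digit _ _ _).
Qed.

(** From [exp (- x) >= 1 - x], hence [exp x <= 1 / (1 - x)]. *)
Lemma expR_le_quad (x : R) : x <= 2^-1 -> expR x <= 1 + x + 2 * x ^+ 2.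
Proof.
move=> x2.
have h := expR_ge1Dx (- x).
have e0 := expR_gt0 x.
have e : expR x * expR (- x) = 1 by rewrite -expRD subrr expR0.
have h1 : expR x * (1 - x) <= 1 by rewrite -[leRHS]e ler_wpM2l// ltW.
have h2 : 1 <= (1 + x + 2 * x ^+ 2) * (1 - x).
  rewrite -subr_ge0 (_ : _ - 1 = x ^+ 2 * (1 - 2 * x)); last by ring.
  by rewrite mulr_ge0 ?sqr_ge0//; lra.
have : expR x * (1 - x) <= (1 + x + 2 * x ^+ 2) * (1 - x) by exact: le_trans h2.
have x1 : 0 < 1 - x by lra.
by rewrite ler_pM2r.
Qed.

(** The centred digit has mean zero, so only the quadratic terms survive; its
    variance [p (1 - p)] is at most 1/4. *)
Lemma chernoff_factor (h : R) : `|h| <= 2^-1 ->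
  p * expR (h * (1 - p)) + (1 - p) * expR (h * (- p)) <= expR (h ^+ 2).
Proof.
have /andP[p0 p1] := p01.
move=> hh; have /andP[h1 h2] : - 2^-1 <= h <= 2^-1 by rewrite -ler_norml.
apply: le_trans (_ : 1 + h ^+ 2 <= _); last exact: expR_ge1Dx.
have e1 : h * (1 - p) <= 2^-1 by nra.
have e2 : h * - p <= 2^-1 by nra.
have a1 := expR_le_quad e1; have a2 := expR_le_quad e2.
apply: le_trans (_ : p * (1 + h * (1 - p) + 2 * (h * (1 - p)) ^+ 2) +
  (1 - p) * (1 + h * - p + 2 * (h * - p) ^+ 2) <= _).
  by apply: lerD; rewrite ler_wpM2l//; lra.
rewrite (_ : _ + _ = 1 + h ^+ 2 * (2 * (p * (1 - p)))); last by ring.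
rewrite lerD2l ler_piMr ?sqr_ge0//.
by have := sqr_ge0 (2 * p - 1); nra.
Qed.

(** Exponential Markov inequality: the indicator of the event is at most
    [exp (h (N - p n) - c n)], [N] being the number of true digits, and the integral
    of this product over the digits factors.  Both signs of [h] are allowed, for the
    two tails. *)
Lemma chernoff n (h c : R) : `|h| <= 2^-1 ->
  (uniform01 [set y : measurableTypeR R |
      (c * n%:R <= h * ((card_upto (digit p ^~ y) n)%:R - p * n%:R))%R]
     <= (expR (h ^+ 2 - c) ^+ n)%:E)%E.
Proof.
move=> hh.
pose F (f : {ffun 'I_n -> bool}) : R :=
  \prod_(i < n) expR (h * ((f i)%:R - p) - c).
have FE y : F (digits p n y) =
    expR (h * ((card_upto (digit p ^~ y) n)%:R - p * n%:R) - c * n%:R).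
  rewrite /F -expR_sum; congr expR; rewrite sumrB -mulr_sumr sumrB !sumr_const card_ord.
  rewrite -[p *+ n]mulr_natr -[c *+ n]mulr_natr /card_upto natr_sum.
  by congr (_ * (_ - _) - _); apply: eq_bigr => i _; rewrite ffunE.
set A := [set y | _].
pose B : {ffun 'I_n -> bool} -> R := fun f =>
   ((c * n%:R <= h * (\sum_(i < n) (f i)%:R - p * n%:R))%R)%:R.
have BE y : B (digits p n y) = \1_A y.
  rewrite /B indicE; congr (_%:R); congr nat_of_bool.
  have -> : (y \in A) = (c * n%:R <= h * ((card_upto (digit p ^~ y) n)%:R - p * n%:R)).
    by apply/idP/idP; rewrite inE.
  rewrite /card_upto natr_sum; congr (_ <= _ * (_ - _)).
  by apply: eq_bigr => i _; rewrite ffunE.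
have mA : measurable A.
  apply/measurable_indicP; apply: eq_measurable_fun (measurable_digits p B) => y _.
  exact: BE.
have -> : uniform01 A = (\int[uniform01]_y (\1_A y)%:E)%E.
    by rewrite integral_indic// setIT.
apply: le_trans (_ : \int[uniform01]_y (F (digits p n y))%:E <= _)%E.
  apply: ge0_le_integral => //.
  - by apply/measurable_EFinP; exact: measurable_indic.
  - by apply/measurable_EFinP; exact: measurable_digits.
  - move=> y _; rewrite lee_fin indicE.
    have [|_] := boolP (y \in A); last by rewrite FE expR_ge0.
    by rewrite inE FE /A /= => yA; apply: le_trans (expR_ge1Dx _); rewrite lerDl subr_ge0.
have iF := @integrable_digits R p n F.
rewrite -[leLHS]fineK; last exact: integrable_fin_num.
rewrite -/(Rintegral _ _ _) lee_fin (integral_digits p01 F).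
rewrite /F /word_weight; under eq_bigr do rewrite -big_split /=.
rewrite -(bigA_distr_bigA (fun (i : 'I_n) (d : bool) =>
  weight p d * expR (h * (d%:R - p) - c))) /=.
have /andP[p0 p1] := p01.
have -> : expR (h ^+ 2 - c) ^+ n = \prod_(i < n) expR (h ^+ 2 - c).
  by rewrite prodr_const card_ord.
apply: ler_prod => i _; rewrite big_bool /weight !expRD.
have := chernoff_factor hh; rewrite sub0r => cf.
apply/andP; split.
  by rewrite addr_ge0// !mulr_ge0 ?expR_ge0//; lra.
by rewrite !mulrA /= -mulrDl ler_wpM2r ?expR_ge0.
Qed.

End bernoulli.

(** * The strong law of large numbers and the conclusion *)

Section strong_law.
Context {R : realType} (p : R).
Hypothesis p01 : 0 < p < 1.

Definition deviation (eps : R) n : set (borel_Omega R) :=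
  [set w | eps * n%:R <= `|(card_upto (ones w) n)%:R - p * n%:R|].

Lemma measurable_deviation eps n : measurable (deviation eps n).
Proof.
pose g (w : borel_Omega R) : measurableTypeR R :=
  (card_upto (ones w) n)%:R - p * n%:R.
have mg : measurable_fun [set: borel_Omega R] g.
  apply: measurable_funB; last exact: measurable_cst.
  under eq_fun do rewrite /card_upto natr_sum.
  apply: measurable_sum => i.
  under eq_fun => w.
    rewrite (_ : (ones w i)%:R = if ones w i then 1 else 0 :> R); last by case: (ones _ _).
    over.
  by apply: measurable_fun_ifT; [exact: measurable_ones|exact: measurable_cst..].
have m : measurable_fun [set: borel_Omega R] (fun w => `|g w| : measurableTypeR R).
  exact: (measurableT_comp (@normr_measurable R setT) mg).
have -> : deviation eps n = (fun w => `|g w| : measurableTypeR R) @^-1`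
    `[eps * n%:R, +oo[%classic.
  by apply/seteqP; split => w /=; rewrite in_itv /= andbT.
rewrite -[X in measurable X]setTI; apply: m => //; exact: measurable_itv.
Qed.

(** The optimal [h = eps / 2] with the threshold [c = h eps] gives
    [h^2 - c = - eps^2 / 4], for each of the two tails. *)
Lemma deviation_le eps n : 0 < eps <= 1 ->
  (bernoulli p (deviation eps n) <= (2 * expR (- (eps ^+ 2 / 4)) ^+ n)%:E)%E.
Proof.
move=> /andP[e0 e1].
have h1 : `|eps / 2| <= 2^-1 by rewrite ger0_norm; lra.
have h2 : `|- (eps / 2)| <= 2^-1 by rewrite normrN.
have c1 := chernoff p01 n (eps ^+ 2 / 2) h1.
have c2 := chernoff p01 n (eps ^+ 2 / 2) h2.
have ex1 : (eps / 2) ^+ 2 - eps ^+ 2 / 2 = - (eps ^+ 2 / 4) by field.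
have ex2 : (- (eps / 2)) ^+ 2 - eps ^+ 2 / 2 = - (eps ^+ 2 / 4) by field.
rewrite ex1 in c1; rewrite ex2 in c2.
set A1 := [set y | _] in c1; set A2 := [set y | _] in c2.
have mA (h c : R) : measurable [set y : measurableTypeR R |
      (c * n%:R <= h * ((card_upto (digit p ^~ y) n)%:R - p * n%:R))%R].
  pose G (f : {ffun 'I_n -> bool}) : R := h * ((\sum_(i < n) f i)%:R - p * n%:R).
  rewrite (_ : [set y | _] = (fun y => G (digits p n y)) @^-1` `[c * n%:R, +oo[%classic).
    rewrite -[X in measurable X]setTI; apply: measurable_digits => //;
      exact: measurable_itv.
  have e y : (\sum_(i < n) digits p n y i)%N = card_upto (digit p ^~ y) n.
    by apply: eq_bigr => i _; rewrite ffunE.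
  by apply/seteqP; split => y /=; rewrite in_itv /= andbT /G e.
rewrite mulr_natl mulr2n EFinD.
apply: le_trans (leeD c1 c2).
apply: le_trans (measureU2 _ _ _); [|exact: mA..].
rewrite /bernoulli /distribution /= /pushforward; apply: le_measure; rewrite ?inE.
- rewrite -[X in measurable X]setTI; apply: measurable_coding => //.
  exact: measurable_deviation.
- by apply: measurableU; exact: mA.
move=> y; rewrite /deviation /= ones_coding /A1 /A2 /=.
set D := _%:R - _.
have n0 : 0 <= n%:R :> R by [].
have [D0|D0] := leP 0 D.
  rewrite ger0_norm// => h; left.
  have : eps / 2 * (eps * n%:R) <= eps / 2 * D by rewrite ler_wpM2l//; lra.
  by rewrite expr2; lra.
rewrite ltr0_norm// => h; right.
have : eps / 2 * (eps * n%:R) <= eps / 2 * - D by rewrite ler_wpM2l//; lra.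
by rewrite expr2; lra.
Qed.

Lemma summable_geometric (c r : R) : 0 <= c -> 0 <= r < 1 ->
  (\sum_(0 <= n <oo) (c * r ^+ n)%:E < +oo)%E.
Proof.
move=> c0 /andP[r0 r1].
have t0 n : 0 <= c * r ^+ n by rewrite mulr_ge0// exprn_ge0.
apply: (@le_lt_trans _ _ (c / (1 - r))%:E); last exact: ltry.
apply: lime_le; first by apply: is_cvg_nneseries => n _ _; rewrite lee_fin.
apply: nearW => n; rewrite sumEFin lee_fin.
have -> : \sum_(0 <= k < n) c * r ^+ k = c * (1 - r ^+ n) / (1 - r).
  elim: n => [|n IH]; first by rewrite big_geq// expr0 subrr mulr0 mul0r.
  by rewrite big_nat_recr//= IH exprS; field; lra.
apply: ler_wpM2r; first by rewrite invr_ge0; lra.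
by rewrite ler_piMr// gerBl exprn_ge0.
Qed.

(** The deviation probabilities are summable, so by Borel-Cantelli almost surely
    only finitely many deviations of size [1 / (k+1)] occur, for every [k]. *)
Lemma bernoulli_lln :
  {ae bernoulli p, forall w, (card_upto (ones w) n)%:R / n%:R @[n --> \oo] --> p}.
Proof.
pose e k : R := k.+1%:R^-1.
have e01 k : 0 < e k <= 1 by rewrite invr_gt0 ltr0n invf_le1 ?ltr0n// ler1n.
have neg k : (bernoulli p).-negligible (lim_sup_set (deviation (e k))).
  have mD n : measurable (deviation (e k) n) by exact: measurable_deviation.
  have mL : measurable (lim_sup_set (deviation (e k))).
    apply: bigcapT_measurable => n; apply: bigcup_measurable => j _; exact: mD.
  apply/negligibleP => //; apply: lim_sup_set_cvg0 => //.
  apply: le_lt_trans (summable_geometric (c := 2) (r := expR (- (e k ^+ 2 / 4))) _ _).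
  - by apply: lee_nneseries => // n _; exact: deviation_le.
  - by [].
  - have /andP[ek _] := e01 k.
    rewrite expR_ge0 /= -[ltRHS]expR0 ltr_expR oppr_lt0 divr_gt0// exprn_gt0//.
have := negligible_bigcup neg; apply: negligibleS => w /= nc.
apply: contrapT => nw; apply: nc; apply/cvgrPdist_lt => eps eps0.
have [k ke] : exists k, e k < eps.
  exists (Num.bound eps^-1).
  rewrite /e invf_plt ?posrE ?ltr0n//.
  apply: lt_le_trans (archi_boundP _) _; first by rewrite invr_ge0 ltW.
  by rewrite ler_nat.
have nl : ~ lim_sup_set (deviation (e k)) w by move=> h; apply: nw; exists k.
have [m hm] : exists m, forall n, (m <= n)%N -> ~ deviation (e k) n w.
  apply: contrapT => H; apply: nl => m _.
  apply: contrapT => H2; apply: H; exists m => n mn dn; apply: H2.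
  by exists n.
near=> n.
have n0 : 0 < n%:R :> R by rewrite ltr0n; near: n; exact: nbhs_infty_gt.
have : ~ deviation (e k) n w by apply: hm; near: n; exact: nbhs_infty_ge.
rewrite /deviation /= => /negP; rewrite -ltNge => h.
apply: lt_trans ke.
rewrite distrC -[X in `|_ - X|](mulfK (lt0r_neq0 n0)) -mulrBl normrM normfV.
by rewrite (gtr0_norm n0) ltr_pdivrMr.
Unshelve. all: by end_near. Qed.

End strong_law.

Theorem corollary6p3 (R : realType) (a b : R)
    (a_gt0 : 0 < a) (a_lt_b : a < b) (b_le1 : b <= 1) :
  exists mu : R.-ker (borel_Omega R) ~> (measurableTypeR R),
    spectral_random_measure mu /\
    forall s : R, a < s -> s < b ->
      exists P : probability (borel_Omega R) R,
        bernoulli_measure P /\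
        {ae P, forall w, hausdorff_dim_measure (mu w) = s%:E}.
Proof.
exists random_kernel; split; first by move=> w; exact: binlaw_spectral.
move=> s as_ sb.
have s0 : 0 < s by exact: lt_trans as_.
have s01 : 0 < s < 1 by rewrite s0 (lt_le_trans sb).
exists (bernoulli s); split; first exact: bernoulli_measureP.
have := bernoulli_lln s01; apply: negligibleS => w /=; apply: contra_not => dens.
exact: binlaw_dim.
Qed.
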